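(* Let $r\ge 3$ be an integer, let $a_1,\dots,a_{r-2}$ be non-zero complex numbers, and let ${}_r^{}W_r^\ast$ be the function of $y\in\mathbb{C}\setminus\{0\}$ defined in the context. Then: (a) The functions ${}_3^{}W_3^\ast$ and ${}_4^{}W_4^\ast$ are identically zero. (b) If $r\ge5$ is odd, then ${}_r^{}W_r^\ast$ takes the form $${}_r^{}W_r^\ast(y)=A\,\theta(y)\,\theta(-y)\,\theta(-y\sqrt q)\prod_{j=1}^{(r-5)/2}\theta\!\left(\frac{y}{\rho_j}\right)\theta(q\rho_jy).$$ (c) If $r\ge6$ is even, then ${}_r^{}W_r^\ast$ takes the form $${}_r^{}W_r^\ast(y)=A\,\theta(y^2)\prod_{j=1}^{(r-6)/2}\theta\!\left(\frac{y}{\rho_j}\right)\theta(q\rho_jy).$$ In both (b) and (c), $A\in\mathbb{C}$ and the $\rho_j\in\mathbb{C}\setminus\{0\}$ are independent of the variable $y$ (although they depend in general on the parameters $a_1,\dots,a_{r-2}$).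
   Context: Throughout, $q\in\mathbb{C}$ with $0<|q|<1$; a square root $\sqrt q$ is fixed, and $q^{(r-4)/2}$ means $(\sqrt q)^{r-4}$. The $q$-Pochhammer symbol $(z)_n$ is defined for all integers $n$ by $(z)_0=1$ and $(z)_{n+1}=(1-zq^n)(z)_n$; $(z)_\infty=\prod_{k\ge0}(1-zq^k)$; and $(z_1,\dots,z_m)_n=(z_1)_n\cdots(z_m)_n$, including $n=\infty$. The theta function is $\theta(z)=(z,q/z,q)_\infty$ for $z\in\mathbb{C}\setminus\{0\}$. Empty products equal $1$. The very-well-poised-balanced series is $${}_rW_r(y)=\sum_{n=-\infty}^\infty\frac{(a_1y,a_2y,\dots,a_{r-2}y)_n}{(qy/a_1,qy/a_2,\dots,qy/a_{r-2})_n}\bigl(1-y^2q^{2n}\bigr)\left(\frac{q^{(r-4)/2}}{a_1a_2\cdots a_{r-2}}\right)^{n},$$ which converges (away from poles in $y$) when $|a_1\cdots a_{r-2}|>|q|^{(r-4)/2}$; for other parameter values it is understood by analytic continuation in the parameters. One writes $${}_rW_r(y)=\frac{{}_r^{}W_r^\ast(y)}{\left(\frac{q^{(r-4)/2}}{a_1a_2\cdots a_{r-2}},\frac{q}{a_1y},\frac{qy}{a_1},\frac{q}{a_2y},\frac{qy}{a_2},\dots,\frac{q}{a_{r-2}y},\frac{qy}{a_{r-2}}\right)_\infty},$$ where the numerator ${}_r^{}W_r^\ast(y)$ is a function of $y$ analytic throughout $\mathbb{C}\setminus\{0\}$. *)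

(* Defs.v *)
From HB Require Import structures.
From mathcomp Require Import all_boot all_order all_algebra.
From mathcomp Require Import complex.
From mathcomp Require Import boolp classical_sets reals topology normedtype.
From mathcomp Require Import sequences.

Set Implicit Arguments.
Unset Strict Implicit.
Unset Printing Implicit Defensive.

Import Order.TTheory GRing.Theory Num.Theory.
Import numFieldNormedType.Exports.

Local Open Scope classical_set_scope.
Local Open Scope ring_scope.

(* MathComp-Analysis puts the norm topology on every [numFieldType], but     *)
(* infers it only when the carrier is presented as one; naming [R[i]] as a   *)
(* [numFieldType] makes limits available on it.                              *)
Definition Cplx (R : realType) : numFieldType := R[i].

Section Defs.
Variable R : realType.
Local Notation C := (Cplx R).
Implicit Types (q s z y : C) (n : int).

(* For n < 0 the recursion (z)_{n+1} = (1 - z q^n) (z)_n is solved downwards *)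
(* from (z)_0 = 1; see [qpochS]. Since 0^-1 = 0 here, [qpoch] has junk value *)
(* 0 at its poles (n < 0 and z q^k = 1 for some n <= k < 0).                 *)
Definition qpoch q z n : C :=
  match n with
  | Posz m => \prod_(k < m) (1 - z * q ^+ k)
  | Negz m => (\prod_(k < m.+1) (1 - z * q ^ (- (k.+1)%:Z)))^-1
  end.

Definition qpoch_inf q z : C := limn (fun m : nat => qpoch q z m%:Z).

Definition theta q z : C :=
  qpoch_inf q z * qpoch_inf q (q / z) * qpoch_inf q q.

Definition bilateral_sum (u : int -> C) : C :=
  limn (series (fun m : nat => u (Posz m)))
  + limn (series (fun m : nat => u (Negz m))).

(* Below, s is the fixed square root of q, so q^((r-4)/2) is s ^ (r - 4),    *)
(* and the parameters a_1, ..., a_{r-2} are indexed by 'I_(r - 2).           *)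

Definition Wratio s r (a : 'I_(r - 2) -> C) : C :=
  s ^ (r%:Z - 4%:Z) / \prod_i a i.

Definition Wterm q s r (a : 'I_(r - 2) -> C) y n : C :=
  (\prod_i qpoch q (a i * y) n) / (\prod_i qpoch q (q * y / a i) n)
  * (1 - y ^+ 2 * q ^ (2 * n)) * Wratio s a ^ n.

(* The sum of the series; it is only meaningful when the series converges    *)
(* (|s|^(r-4) < |a_1 ... a_{r-2}|) and y is not a pole.                      *)
Definition Wseries q s r (a : 'I_(r - 2) -> C) y : C :=
  bilateral_sum (Wterm q s a y).

Definition Wden q s r (a : 'I_(r - 2) -> C) y : C :=
  qpoch_inf q (Wratio s a)
  * \prod_i (qpoch_inf q (q / (a i * y)) * qpoch_inf q (q * y / a i)).

(* y is not a pole of any term: no factor of (q y / a_i)_n with n >= 0, and  *)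
(* no factor inverted in (a_i y)_n with n < 0, vanishes.                     *)
Definition not_pole q r (a : 'I_(r - 2) -> C) y : Prop :=
  forall (i : 'I_(r - 2)) (k : nat),
    q * y / a i * q ^+ k != 1 /\ a i * y * q ^ (- (k.+1)%:Z) != 1.

Definition analytic_at (f : C -> C) (z : C) : Prop :=
  exists (c : nat -> C) (e : C), 0 < e /\
    forall h : C, `|h| < e ->
      series (fun m : nat => c m * h ^+ m) @ \oo --> f (z + h).

Definition analytic_off0 (f : C -> C) : Prop :=
  forall z : C, z != 0 -> analytic_at f z.

(* W is the numerator function (a, y) |-> W^*(y) of the very-well-poised-    *)
(* balanced series: it is analytic in y and in each a_i on the punctured     *)
(* plane (by Hartogs this is joint analyticity on (C \ {0})^(r-1)), and it   *)
(* is given by the series where the latter converges, y being off the poles. *)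
(* These conditions determine W for all nonzero a_i and y, by analytic       *)
(* continuation.                                                             *)
Definition is_Wstar q s r (W : ('I_(r - 2) -> C) -> C -> C) : Prop :=
  [/\ forall a, (forall i, a i != 0) -> analytic_off0 (W a),
      forall a (i : 'I_(r - 2)) y, (forall j, a j != 0) -> y != 0 ->
        analytic_off0 (fun t => W [eta a with i |-> t] y)
    & forall a y, (forall i, a i != 0) -> y != 0 -> not_pole q a y ->
        `|s ^ (r%:Z - 4%:Z)| < `|\prod_i a i| ->
        Wseries q s a y = W a y / Wden q s a y].

Lemma qpoch0 q z : qpoch q z 0 = 1.
Proof. by rewrite -[0]/(Posz 0) /qpoch big_ord0. Qed.

Lemma qpochS q z n : (n < 0 -> 1 - z * q ^ n != 0) ->
  qpoch q z (n + 1) = (1 - z * q ^ n) * qpoch q z n.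
Proof.
case: n => [m _|m].
  by rewrite -PoszD addn1 /qpoch big_ord_recr /= mulrC.
move=> /(_ isT); rewrite NegzE => nz.
case: m nz => [|m] nz.
  by rewrite addNr qpoch0 -NegzE /qpoch big_ord_recl big_ord0 mulr1 mulfV.
have -> : - (m.+2)%:Z + 1 = Negz m.
  by rewrite NegzE -(addn1 m.+1) PoszD opprD -addrA addNr addr0.
by rewrite -NegzE /qpoch [in RHS]big_ord_recr /= invfM mulrCA mulfV // mulr1.
Qed.

End Defs.

Arguments is_Wstar {R} q s r W.

(* Main.v *)
Require Import Defs.
From mathcomp Require Import all_boot all_order all_algebra.
From mathcomp Require Import complex ring lra zify.
From mathcomp Require Import boolp classical_sets reals topology normedtype.
From mathcomp Require Import sequences exp.
Set Implicit Arguments.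
Unset Strict Implicit.
Unset Printing Implicit Defensive.
Import Order.TTheory GRing.Theory Num.Theory.
Import numFieldNormedType.Exports.
Local Open Scope classical_set_scope.
Local Open Scope ring_scope.

(** Write f for the function y |-> W a y.  Two substitutions in the bilateral
series give functional equations for f: the shift n -> n + 1 relates the
series at y and at q y, the reflection n -> - n relates it at y and at 1 / y.
After multiplication by the denominator the parameters disappear from the
multipliers:

    f (q y) = (-1)^r s^(4-r) y^(2-r) f y,      f (1 / y) = - f y / y^2.

They hold first where the series converges, off the poles; then for every y
by continuity, and for every parameter vector by analytic continuation in one
parameter ([Wstar_shift], [Wstar_recip]).

The rest concerns an arbitrary analytic solution f of these equations.  They
force zeros at 1, -1, -1/s, and also at 1/s when r is even; modulo powers of q
these are the zeros of the factor P of the formulas that precedes the product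
over j, that is theta y theta (-y) theta (-y s) or theta (y^2).  The central
tool is [theta_prod_rigidity]: an analytic f with the multiplier of a product
of theta functions with simple zeros, vanishing at these zeros, is a constant
multiple of the product.  For f and the product Q have the same
quasi-periodicity, so f / Q is bounded by its values on a compact annulus; if
M is the least bound for |f| / |Q|, some local value of f / Q has modulus M,
and the maximum modulus principle makes f / Q constant ([rigidity]).

The functions h_rho y = theta (y / rho) * theta (q rho y) are even under
y -> 1 / y and share one multiplier.  Rigidity shows that they span a space
of dimension two and that every element of it is again a multiple of some
h_rho ([even_pair_span], [even_pair_factor]): an element without zeros would
divide h_alpha with a constant quotient.  Lagrange interpolation at m + 1
points then writes f as P times a binary form of degree m in two fixed pairs
h_alpha, h_beta, the error vanishing by rigidity; over the complex numbers
the form splits into linear factors, and each of them is a multiple of some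
h_rho ([symmetric_theta_product]).  For r = 3, 4 the product f h_rho is a
multiple of P; since it vanishes at rho and P does not, f = 0
([symmetric_theta_vanish]).

Analyticity enters through iterated difference quotients with geometric bounds
([holo]).  They are stable under sums, products and infinite products, and
they yield the order of vanishing at a point, hence the identity theorem and
the maximum modulus principle. *)

(** * The modulus of a complex number as a real number *)

(** The norm of a [numFieldType] has values in the field itself, where the order
is partial; infima and least bounds call for a modulus with values in R. *)
Definition modulus (R : realType) (z : Cplx R) : R := ComplexField.Normc.normc z.
Arguments modulus : simpl never.

Section Modulus.
Variable R : realType.
Local Notation C := (Cplx R).
Local Notation nm := (@modulus R).
Implicit Types (z w : C) (x : R).

Lemma normE z : `|z| = (nm z)%:C%C :> C. Proof. by []. Qed.

Lemma lt_nm z w : (`|z| < `|w|) = (nm z < nm w).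
Proof. by rewrite !normE ltcR. Qed.

Lemma nm0 : nm 0 = 0. Proof. exact: ComplexField.Normc.normc0. Qed.
Lemma nm1 : nm 1 = 1. Proof. exact: ComplexField.Normc.normc1. Qed.
Lemma nmM z w : nm (z * w) = nm z * nm w.
Proof. exact: ComplexField.Normc.normcM. Qed.
Lemma nmV z : nm z^-1 = (nm z)^-1.
Proof. exact: ComplexField.Normc.normcV. Qed.
Lemma nmf_div z w : nm (z / w) = nm z / nm w.
Proof. by rewrite nmM nmV. Qed.
Lemma nm_ge0 z : 0 <= nm z.
Proof. by rewrite -ler0c -normE normr_ge0. Qed.
Lemma nm_eq0 z : (nm z == 0) = (z == 0).
Proof.
apply/eqP/eqP => [|->]; last exact: nm0.
exact: ComplexField.Normc.eq0_normc.
Qed.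
Lemma nm_gt0 z : (0 < nm z) = (z != 0).
Proof. by rewrite lt_neqAle nm_ge0 andbT eq_sym nm_eq0. Qed.
Lemma nmN z : nm (- z) = nm z.
Proof. by apply: (@complexI R); rewrite -!normE normrN. Qed.
Lemma nmBC z w : nm (z - w) = nm (w - z).
Proof. by rewrite -nmN opprB. Qed.
Lemma nmD z w : nm (z + w) <= nm z + nm w.
Proof. by have := ler_normD z w; rewrite !normE -(rmorphD (real_complex R)) lecR. Qed.
Lemma nmB z w : nm (z - w) <= nm z + nm w.
Proof. by rewrite -(nmN w); exact: nmD. Qed.
Lemma nm_lower z w : nm z - nm w <= nm (z - w).
Proof. by rewrite lerBlDr -{1}(subrK w z); exact: nmD. Qed.
Lemma nm_lowerD z w : nm z - nm w <= nm (z + w).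
Proof. by rewrite -(nmN w) -{2}(opprK w); exact: nm_lower. Qed.
Lemma nm_dist z w u : nm (z - w) <= nm (z - u) + nm (u - w).
Proof. by rewrite -(subrKA u); exact: nmD. Qed.
Lemma nmX z n : nm (z ^+ n) = nm z ^+ n.
Proof. by elim: n => [|n IH]; rewrite ?expr0 ?nm1 // !exprS nmM IH. Qed.
Lemma nmXz z (n : int) : nm (z ^ n) = nm z ^ n.
Proof. by case: n => n; rewrite /exprz ?nmV nmX. Qed.
Lemma nm_real x : nm (x%:C%C) = `|x|.
Proof. by rewrite /modulus /ComplexField.Normc.normc /= expr0n /= addr0 sqrtr_sqr. Qed.
Lemma nm_pos x : 0 <= x -> nm (x%:C%C) = x.
Proof. by move=> x0; rewrite nm_real ger0_norm. Qed.
Lemma nm_sum I (r : seq I) (P : pred I) (F : I -> C) :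
  nm (\sum_(i <- r | P i) F i) <= \sum_(i <- r | P i) nm (F i).
Proof.
elim/big_rec2: _ => [|i y x _ IH]; first by rewrite nm0.
by apply: le_trans (nmD _ _) _; rewrite lerD2l.
Qed.
Lemma nm_prod I (r : seq I) (P : pred I) (F : I -> C) :
  nm (\prod_(i <- r | P i) F i) = \prod_(i <- r | P i) nm (F i).
Proof. by apply: (big_morph nm nmM nm1). Qed.

Lemma near_nmP z (P : C -> Prop) :
  (\forall w \near z, P w) <->
  exists2 d : R, 0 < d & forall w, nm (w - z) < d -> P w.
Proof.
split.
  move=> /nbhs_ballP[e /= e0 eP].
  move: (e0); rewrite ltcE => /andP[/= /eqP ei er].
  have eE : e = (complex.Re e)%:C%C by case: e ei {e0 er eP} => a b /= ->.
  exists (complex.Re e) => // y yd; apply: eP.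
  by rewrite /ball /= normE eE ltcR nmBC.
move=> [d d0 dP]; apply/nbhs_ballP; exists (real_complex R d : C) => /=; first by rewrite ltcR.
by move=> y; rewrite /ball /= normE ltcR nmBC; exact: dP.
Qed.

Lemma cvg_nmP T (F : set_system T) {FF : Filter F} (f : T -> C) (l : C) :
  (f @ F --> l) <-> ((fun t => nm (f t - l)) @ F --> (0 : R)).
Proof.
split => fl.
  apply/cvgrPdist_lt => e e0.
  have /fl : nbhs l [set y | nm (y - l) < e].
    by apply/near_nmP; exists e.
  rewrite /nbhs /=; apply: filterS => t /=.
  by rewrite sub0r normrN ger0_norm ?nm_ge0.
move=> P /near_nmP[d d0 dP].
move/cvgrPdist_lt: fl => /(_ _ d0); apply: filterS => t /=.
by rewrite sub0r normrN ger0_norm ?nm_ge0 //; exact: dP.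
Qed.

Lemma cvg_nm T (F : set_system T) {FF : Filter F} (f : T -> C) (l : C) :
  f @ F --> l -> (fun t => nm (f t)) @ F --> nm l.
Proof.
move=> /cvg_nmP/cvgrPdist_lt fl; apply/cvgrPdist_lt => e e0.
move: (fl _ e0); apply: filterS => t.
rewrite sub0r normrN ger0_norm ?nm_ge0 //; apply: le_lt_trans.
rewrite ler_norml; apply/andP; split.
  by rewrite lerNl opprB; exact: nm_lower.
by rewrite nmBC; exact: nm_lower.
Qed.

Lemma cvg_atP (f : C -> C) z (l : C) : f @ z --> l <->
  forall e : R, 0 < e ->
    exists2 d : R, 0 < d & forall w, nm (w - z) < d -> nm (f w - l) < e.
Proof.
split=> [fl e e0|fl].
  apply/near_nmP; apply: (fl [set v | nm (v - l) < e]).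
  by apply/near_nmP; exists e.
move=> P /near_nmP[e e0 eP]; have [d d0 dP] := fl _ e0.
by apply/near_nmP; exists d => // w /dP/eP.
Qed.

Lemma cvg_nm_le T (F : set_system T) {FF : Filter F} (f : T -> C) (l : C)
    (g : T -> R) : (\forall t \near F, nm (f t - l) <= g t) -> g @ F --> (0 : R) ->
  f @ F --> l.
Proof.
move=> fg g0; apply/cvg_nmP; apply: (squeeze_cvgr _ (cvg_cst (0 : R)) g0).
by apply: filterS fg => t ->; rewrite nm_ge0.
Qed.

Lemma nm_le_lim (u : nat -> C) l (B : R) : u @ \oo --> l ->
  (forall n, nm (u n) <= B) -> nm l <= B.
Proof.
move=> /cvg_nm ul uB; have <- := cvg_lim (@Rhausdorff R) ul.
apply: limr_le; first by apply/cvg_ex; eexists; exact: ul.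
by near=> n; exact: uB.
Unshelve. all: by end_near. Qed.

Lemma nm_ReIm z : nm z <= `|complex.Re z| + `|complex.Im z|.
Proof.
have -> : z = ((complex.Re z)%:C + 'i * (complex.Im z)%:C)%C by rewrite -complexE.
apply: le_trans (nmD _ _) _; rewrite nmM !nm_real.
by rewrite -complexE /modulus /= expr0n /= add0r expr1n sqrtr1 mul1r.
Qed.

Lemma Re_le_nm z : `|complex.Re z| <= nm z.
Proof. by have := normc_ge_Re z; rewrite normE lecR. Qed.

Lemma Im_le_nm z : `|complex.Im z| <= nm z.
Proof.
have -> : complex.Im z = complex.Re (- ('i%C * z)) by case: z => a b; rewrite /= mul0r mul1r sub0r opprK.
apply: le_trans (Re_le_nm _) _; rewrite nmN nmM.
by rewrite /modulus /= expr0n /= add0r expr1n sqrtr1 mul1r.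
Qed.

(** Completeness of the complex plane, from that of the real and imaginary axes. *)
Lemma nm_cauchy_cvg (u : nat -> C) :
  (forall e : R, 0 < e -> exists N, forall n, (N <= n)%N -> nm (u n - u N) < e) ->
  exists l : C, u @ \oo --> l.
Proof.
move=> uC.
have aux (p : C -> R) : (forall z w, p (z - w) = p z - p w) ->
    (forall z, `|p z| <= nm z) -> cvgn (p \o u).
  move=> pB pn; apply/cauchy_cvgP/cauchy_exP => e e0.
  have [N uN] := uC _ e0.
  exists (p (u N)); exists N => // n /= Nn.
  rewrite /ball /= distrC -pB; apply: le_lt_trans (pn _) _.
  exact: uN.
have ReB (z w : C) : complex.Re (z - w) = complex.Re z - complex.Re w.
  by case: z w => [? ?] [? ?].
have ImB (z w : C) : complex.Im (z - w) = complex.Im z - complex.Im w.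
  by case: z w => [? ?] [? ?].
have /cvg_ex[/= a ua] := aux (@complex.Re R) ReB Re_le_nm.
have /cvg_ex[/= b ub] := aux (@complex.Im R) ImB Im_le_nm.
exists ((a +i* b)%C : C).
apply: (@cvg_nm_le _ _ _ _ _ (fun n => `|complex.Re (u n) - a| + `|complex.Im (u n) - b|)).
  by near=> n; apply: le_trans (nm_ReIm _) _; case: (u n) => x y.
rewrite -[0 : R]addr0; apply: cvgD.
  by apply/norm_cvg0P/subr_cvg0.
by apply/norm_cvg0P/subr_cvg0.
Unshelve. all: by end_near. Qed.

Lemma at_cst z (c : C) : (fun=> c) @ z --> c.
Proof. exact: (@cvg_cst C c C (nbhs z) (nbhs_filter z)). Qed.
Lemma at_id z : (fun y : C => y) @ z --> z.
Proof. by []. Qed.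
Lemma at_add (f g : C -> C) z (a b : C) : f @ z --> a -> g @ z --> b ->
  (fun y => f y + g y) @ z --> a + b.
Proof. exact: (@cvgD C C C (nbhs z) (nbhs_filter z)). Qed.
Lemma at_sub (f g : C -> C) z (a b : C) : f @ z --> a -> g @ z --> b ->
  (fun y => f y - g y) @ z --> a - b.
Proof. exact: (@cvgB C C C (nbhs z) (nbhs_filter z)). Qed.
Lemma at_mul (f g : C -> C) z (a b : C) : f @ z --> a -> g @ z --> b ->
  (fun y => f y * g y) @ z --> a * b.
Proof. exact: (@cvgM C C (nbhs z) (nbhs_filter z)). Qed.
Lemma at_inv (f : C -> C) z (a : C) : a != 0 -> f @ z --> a ->
  (fun y => (f y)^-1) @ z --> a^-1.
Proof. exact: (@cvgV C C (nbhs z) (nbhs_filter z)). Qed.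
Lemma at_eq (f g : C -> C) z (a : C) : (\forall y \near z, f y = g y) ->
  f @ z --> a -> g @ z --> a.
Proof.
move=> /near_nmP[d d0 fg] /cvg_atP fa; apply/cvg_atP => e e0.
have [d' d'0 fe] := fa e e0; exists (Num.min d d'); first by rewrite lt_min d0.
by move=> y; rewrite lt_min => /andP[/fg <-]; exact: fe.
Qed.
End Modulus.

(** * Infinite products with geometrically decreasing factors *)

Section GeometricProducts.
Variable R : realType.
Local Notation C := (Cplx R).
Local Notation nm := (@modulus R).
Variables (c x : R) (w : nat -> C).
Hypotheses (c0 : 0 <= c) (x0 : 0 <= x) (x1 : x < 1).
Hypothesis wb : forall k, nm (w k) <= c * x ^+ k.

Let t0 : 0 < 1 - x. Proof. by rewrite subr_gt0. Qed.

Lemma geom_sum_le m n : \sum_(m <= k < n) c * x ^+ k <= c * x ^+ m / (1 - x).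
Proof.
have [mn|nm_] := leqP m n; last first.
  by rewrite big_geq ?(ltnW nm_) // divr_ge0 ?mulr_ge0 ?exprn_ge0 // ltW.
have -> : \sum_(m <= k < n) c * x ^+ k = (c * x ^+ m - c * x ^+ n) / (1 - x).
  elim: n mn => [|n IH mn].
    by rewrite leqn0 => /eqP ->; rewrite big_geq // subrr mul0r.
  move: mn; rewrite leq_eqVlt => /orP[/eqP->|mn]; first by rewrite big_geq // subrr mul0r.
  rewrite big_nat_recr //= IH // exprS; field; exact: lt0r_neq0.
by rewrite ler_pM2r ?invr_gt0 // gerBl mulr_ge0 ?exprn_ge0.
Qed.

(** The bound for the tails of all the products and series below. *)
Lemma geom_tail_cvg0 : (fun m => c * x ^+ m / (1 - x)) @ \oo --> (0 : R).
Proof.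
rewrite -(mul0r (1 - x)^-1); apply: cvgM; last exact: cvg_cst.
rewrite -(mulr0 c); apply: cvgM; first exact: cvg_cst.
by apply: cvg_expr; rewrite ger0_norm.
Qed.

Lemma prod_exp_le m n :
  \prod_(m <= k < n) (1 + c * x ^+ k) <= expR (c / (1 - x)).
Proof.
apply: (@le_trans _ _ (expR (\sum_(m <= k < n) c * x ^+ k))).
  rewrite expR_sum; apply: ler_prod => k _.
  by rewrite expR_ge1Dx addr_ge0 // mulr_ge0 // exprn_ge0.
rewrite ler_expR; apply: le_trans (geom_sum_le _ _) _.
rewrite ler_pM2r ?invr_gt0 // ler_piMr // exprn_ile1 // ltW //.
Qed.

Lemma prod_le m n : nm (\prod_(m <= k < n) (1 - w k)) <= expR (c / (1 - x)).
Proof.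
apply: le_trans (prod_exp_le m n); rewrite nm_prod; apply: ler_prod => k _.
by rewrite nm_ge0 /=; apply: le_trans (nmB _ _) _; rewrite nm1 lerD2l.
Qed.

Lemma prod_cvg : exists l : C, (fun n => \prod_(k < n) (1 - w k)) @ \oo --> l.
Proof.
pose B := expR (c / (1 - x)).
have B0 : 0 <= B by exact: expR_ge0.
have step n : nm (\prod_(k < n.+1) (1 - w k) - \prod_(k < n) (1 - w k))
      <= B * (c * x ^+ n).
  rewrite big_ord_recr /= -[X in _ - X]mulr1 -mulrBr addrAC subrr add0r nmM nmN.
  by rewrite ler_pM ?nm_ge0 // -(big_mkord xpredT (fun k => 1 - w k)) prod_le.
have r0 : (fun m => B * (c * x ^+ m / (1 - x))) @ \oo --> (0 : R).
  by rewrite -(mulr0 B); apply: cvgM; [exact: cvg_cst|exact: geom_tail_cvg0].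
apply: nm_cauchy_cvg => e e0.
move/cvgrPdist_lt: r0 => /(_ _ e0) [m _ /(_ m (leqnn m))].
rewrite sub0r normrN => /(le_lt_trans (ler_norm _)) me.
exists m => n mn; apply: le_lt_trans me.
apply: le_trans (_ : B * (\sum_(m <= k < n) c * x ^+ k) <= _); last first.
  by rewrite ler_wpM2l // geom_sum_le.
elim: n mn => [|n IH]; first by rewrite leqn0 => /eqP ->; rewrite subrr nm0 big_geq // mulr0.
rewrite leq_eqVlt => /orP[/eqP->|mn]; first by rewrite subrr nm0 big_geq // mulr0.
apply: le_trans (nm_dist _ _ (\prod_(k < n) (1 - w k))) _.
by rewrite big_nat_recr //= mulrDr addrC; apply: lerD; [exact: IH|exact: step].
Qed.

(** A tail whose factors deviate from 1 by at most 1/2 in total stays above 1/2,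
by the Weierstrass inequality; finitely many factors remain. *)
Lemma prod_lower : (forall k, 1 - w k != 0) ->
  exists2 e : R, 0 < e & forall n, e <= nm (\prod_(k < n) (1 - w k)).
Proof.
move=> wn0.
have [N hN] : exists N, c * x ^+ N / (1 - x) <= 1 / 2.
  have := geom_tail_cvg0; move=> /cvgrPdist_lt/(_ (1 / 2))[|N _ /(_ N (leqnn N))]; first by lra.
  by rewrite sub0r normrN => /ltW h; exists N; apply: le_trans h; rewrite ler_norm.
have tail n : 1 - \sum_(N <= k < n) c * x ^+ k <= nm (\prod_(N <= k < n) (1 - w k)).
  have [Nn|nN] := leqP N n; last by rewrite !big_geq ?(ltnW nN) // subr0 nm1.
  elim: n Nn => [|n IH].
    by rewrite leqn0 => /eqP ->; rewrite !big_geq // subr0 nm1.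
  rewrite leq_eqVlt => /orP[/eqP->|Nn]; first by rewrite !big_geq // subr0 nm1.
  rewrite !big_nat_recr //= nmM.
  have h1 := IH Nn.
  have h2 : 1 - c * x ^+ n <= nm (1 - w n).
    by have := nm_lower 1 (w n); rewrite nm1; have := wb n; lra.
  have s1 := le_trans (geom_sum_le N n.+1) hN.
  rewrite big_nat_recr //= in s1.
  have s0 : 0 <= \sum_(N <= k < n) c * x ^+ k.
    by apply: sumr_ge0 => k _; rewrite mulr_ge0 ?exprn_ge0.
  have b0 : 0 <= c * x ^+ n by rewrite mulr_ge0 ?exprn_ge0.
  move: h1 h2 s1 s0 b0 => {IH}.
  move: (\sum_(N <= k < n) _) (c * x ^+ n) (nm _) (nm _) => S b p p' *.
  nra.
pose B := expR (c / (1 - x)).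
have B0 : 0 < B by exact: expR_gt0.
have B1 : 1 <= B.
  by rewrite -expR0 ler_expR divr_ge0 // ltW.
pose e := nm (\prod_(0 <= k < N) (1 - w k)).
have e0 : 0 < e by rewrite nm_gt0 prodf_seq_neq0; apply/allP => k _; exact: wn0.
exists (e / (2 * B)); first by rewrite divr_gt0 // mulr_gt0.
move=> n; rewrite -(big_mkord xpredT (fun k => 1 - w k)).
rewrite ler_pdivrMr ?mulr_gt0 //.
have [nN|Nn] := leqP n N.
  have -> : e = nm (\prod_(0 <= k < n) (1 - w k)) * nm (\prod_(n <= k < N) (1 - w k)).
    by rewrite -nmM -big_cat_nat.
  rewrite ler_wpM2l ?nm_ge0 //; apply: le_trans (prod_le _ _) _.
  by rewrite -/B; lra.
rewrite (big_cat_nat (n := N)) ?(ltnW Nn) //= nmM -/e -mulrA ler_peMr ?(ltW e0) //.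
have := tail n; have := le_trans (geom_sum_le N n) hN.
by move: (\sum_(N <= k < n) _) (nm _) => S p *; nra.
Qed.

Lemma prod_lim_neq0 l : (forall k, 1 - w k != 0) ->
  (fun n => \prod_(k < n) (1 - w k)) @ \oo --> l -> l != 0.
Proof.
move=> /prod_lower[e e0 he] /cvg_nm ul; rewrite -nm_gt0; apply: (lt_le_trans e0).
rewrite -(cvg_lim (@Rhausdorff R) ul).
apply: limr_ge; first by apply/cvg_ex; eexists; exact: ul.
by near=> n; exact: he.
Unshelve. all: by end_near. Qed.

End GeometricProducts.

Section QPochhammer.
Variable R : realType.
Local Notation C := (Cplx R).
Local Notation nm := (@modulus R).
Variable q : C.
Hypothesis (q1 : nm q < 1).

Lemma nm_qfactor z k : nm (z * q ^+ k) <= nm z * nm q ^+ k.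
Proof. by rewrite nmM nmX. Qed.

Lemma qpoch_inf_cvg z :
  (fun m : nat => \prod_(k < m) (1 - z * q ^+ k)) @ \oo --> qpoch_inf q z.
Proof.
have [l ul] := prod_cvg (nm_ge0 z) (nm_ge0 q) q1 (nm_qfactor z).
by rewrite /qpoch_inf (cvg_lim _ ul) //; exact: norm_hausdorff.
Qed.

Lemma qpoch_inf_lim z l :
  (fun m : nat => \prod_(k < m) (1 - z * q ^+ k)) @ \oo --> l -> qpoch_inf q z = l.
Proof.
by move=> ul; rewrite /qpoch_inf (cvg_lim _ ul) //; exact: norm_hausdorff.
Qed.

Lemma qpoch_infS z : qpoch_inf q z = (1 - z) * qpoch_inf q (z * q).
Proof.
apply: qpoch_inf_lim; rewrite -cvg_shiftS.
have : (fun n : nat => (1 - z) * \prod_(k < n) (1 - z * q * q ^+ k)) @ \oo -->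
    (1 - z) * qpoch_inf q (z * q).
  by apply: cvgM; [exact: cvg_cst|exact: qpoch_inf_cvg].
apply: cvg_trans; apply: near_eq_cvg; near=> n.
rewrite /= [RHS]big_ord_recl /= expr0 mulr1; congr (_ * _); apply: eq_bigr => k _.
by rewrite /bump /= add1n exprS mulrA.
Unshelve. all: by end_near. Qed.

Lemma qpoch_inf_neq0 z : (forall k, z * q ^+ k != 1) -> qpoch_inf q z != 0.
Proof.
move=> zk; apply: (prod_lim_neq0 (nm_ge0 z) (nm_ge0 q) q1 (nm_qfactor z)); last exact: qpoch_inf_cvg.
by move=> k; rewrite subr_eq0 eq_sym.
Qed.

Lemma qpoch_le z m : nm (\prod_(k < m) (1 - z * q ^+ k)) <= expR (nm z / (1 - nm q)).
Proof.
rewrite -(big_mkord xpredT (fun k => 1 - z * q ^+ k)).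
exact: (prod_le (nm_ge0 z) (nm_ge0 q) q1 (nm_qfactor z)).
Qed.

Lemma qpoch_lower z : (forall k, z * q ^+ k != 1) ->
  exists2 e : R, 0 < e & forall m, e <= nm (\prod_(k < m) (1 - z * q ^+ k)).
Proof.
move=> zk; apply: (prod_lower (nm_ge0 z) (nm_ge0 q) q1 (nm_qfactor z)).
by move=> k; rewrite subr_eq0 eq_sym.
Qed.

End QPochhammer.

(** * Analyticity through iterated difference quotients *)

Section DifferenceTowers.
Variable R : realType.
Local Notation C := (Cplx R).
Local Notation nm := (@modulus R).
Implicit Types (F G : nat -> C -> C) (f g : C -> C) (z h : C) (M r d : R).

(** [F n] plays the role of the [n]-th iterated difference quotient at 0 of
[F 0]; its value at 0 is the [n]-th Taylor coefficient.  Unlike a power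
series, a tower is multiplied, bounded and passed to the limit through finite
expressions only, without any rearrangement of double series. *)
Definition tower F M r d :=
  forall n h, nm h <= d ->
    F n h = F n 0 + h * F n.+1 h /\ nm (F n h) <= M * r ^+ n.

Lemma tower_weaken F M r d M' r' d' : M <= M' -> 0 <= M -> 0 <= r -> r <= r' -> d' <= d ->
  tower F M r d -> tower F M' r' d'.
Proof.
move=> MM' M0 r0 rr' dd' tF n h hd.
have [eF Fb] := tF n h (le_trans hd dd').
split=> //; apply: le_trans Fb _; apply: ler_pM => //; first exact: exprn_ge0.
by apply: lerXn2r => //; rewrite nnegrE // (le_trans r0).
Qed.

Lemma tower_add F G M M' r d : tower F M r d -> tower G M' r d ->
  tower (fun n h => F n h + G n h) (M + M') r d.
Proof.
move=> tF tG n h hd; have [eF bF] := tF n h hd; have [eG bG] := tG n h hd.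
split; first by rewrite {1}eF {1}eG; ring.
by apply: le_trans (nmD _ _) _; rewrite mulrDl lerD.
Qed.

Lemma tower_scale F M r d (c : C) : tower F M r d ->
  tower (fun n h => c * F n h) (nm c * M) r d.
Proof.
move=> tF n h hd; have [eF bF] := tF n h hd.
split; first by rewrite {1}eF; ring.
by rewrite nmM -mulrA ler_wpM2l ?nm_ge0.
Qed.

Lemma tower_opp F M r d : tower F M r d -> tower (fun n h => - F n h) M r d.
Proof.
move=> tF n h hd; have [eF bF] := tF n h hd.
by split; [rewrite {1}eF; ring|rewrite nmN].
Qed.

Lemma tower_cst (c : C) r d : 0 <= r ->
  tower (fun n h => if n is 0 then c else 0) (nm c) r d.
Proof.
move=> r0 [|n] h hd; rewrite /= mulr0 addr0; split=> //; first by rewrite expr0 mulr1.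
by rewrite nm0 mulr_ge0 ?exprn_ge0 ?nm_ge0.
Qed.

(** The Leibniz rule for difference quotients, S (f g) = f(0) S g + (S f) g,
iterated n times. *)
Definition mul_tower F G n h :=
  \sum_(0 <= k < n) F k 0 * G (n - k)%N h + F n h * G 0%N h.

(** With rates r and 2 r the products of the bounds in the Leibniz sum form a
geometric series of ratio 1/2, hence the factor 2; with equal rates they would
add up to n + 1 times the same bound. *)
Lemma tower_mul F G M M' r d : 0 <= M -> 0 <= M' -> 0 <= r -> 0 <= d ->
  tower F M r d -> tower G M' (2 * r) d ->
  tower (mul_tower F G) (2 * M * M') (2 * r) d.
Proof.
move=> M0 M'0 r0 d0 tF tG n h hd; rewrite /mul_tower.
have h00 : nm 0 <= d by rewrite nm0.
have [eF bF] := tF n h hd; have [eG bG] := tG 0%N h hd.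
split.
  rewrite big_nat_recr //= subSnn.
  have -> : \sum_(0 <= k < n) F k 0 * G (n - k)%N h =
     \sum_(0 <= k < n) F k 0 * G (n - k)%N 0 + h * \sum_(0 <= k < n) F k 0 * G (n.+1 - k)%N h.
    rewrite mulr_sumr -big_split /=; apply: eq_big_nat => k /andP[_ kn].
    by have [-> _] := tG (n - k)%N h hd; rewrite subSn ?(ltnW kn) //; ring.
  by rewrite eF mulrDl {1}eG; ring.
have bG0 : nm (G 0%N h) <= M' by rewrite -[M']mulr1 -(expr0 (2 * r)).
apply: (@le_trans _ _ (\sum_(0 <= k < n) M * M' * (2 * r) ^+ n * 2^-1 ^+ k
    + M * M' * (2 * r) ^+ n * 2^-1 ^+ n)).
  apply: le_trans (nmD _ _) _; apply: lerD.
    apply: le_trans (nm_sum _ _ _) _; rewrite big_nat [leRHS]big_nat.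
    apply: ler_sum => k /andP[_ kn]; rewrite nmM.
    have [_ b1] := tF k 0 h00; have [_ b2] := tG (n - k)%N h hd.
    apply: le_trans (ler_pM (nm_ge0 _) (nm_ge0 _) b1 b2) _.
    rewrite le_eqVlt; apply/orP; left; apply/eqP.
    have -> : (2 * r) ^+ n = (2 * r) ^+ (n - k) * (2 ^+ k * r ^+ k).
      by rewrite -exprMn -exprD subnK // ltnW.
    by rewrite exprVn; field; rewrite expf_neq0 // pnatr_eq0.
  rewrite nmM; apply: le_trans (ler_pM (nm_ge0 _) (nm_ge0 _) bF bG0) _.
  rewrite le_eqVlt; apply/orP; left; apply/eqP.
  by rewrite exprMn exprVn; field; rewrite expf_neq0 // pnatr_eq0.
rewrite -mulr_sumr -mulrDr.
have -> : \sum_(0 <= k < n) 2^-1 ^+ k + 2^-1 ^+ n = 2 - 2^-1 ^+ n :> R.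
  elim: n {hd eF bF} => [|n IH]; first by rewrite big_geq // expr0; ring.
  by rewrite big_nat_recr //= IH !exprS; field.
have p0 : 0 <= (2^-1 : R) ^+ n by rewrite exprn_ge0 // invr_ge0.
have q0 : 0 <= M * M' * (2 * r) ^+ n by rewrite !mulr_ge0 // exprn_ge0 // mulr_ge0.
by move: p0 q0; move: (2^-1 ^+ n) ((2 * r) ^+ n) => p s p0 q0; nra.
Qed.

(** A pointwise limit of uniformly bounded towers is a tower (Weierstrass).
The difference quotients off 0 converge because those of lower order do.  At
0 no quotient is available; there the values form a Cauchy sequence, as they
differ from the values at a small h by at most a constant times |h|. *)
Lemma tower_lim (F : nat -> nat -> C -> C) (f : C -> C) M r d :
  0 <= M -> 0 <= r -> 0 < d ->
  (forall N, tower (F N) M r d) ->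
  (forall h, nm h <= d -> (fun N => F N 0%N h) @ \oo --> f h) ->
  exists2 G, tower G M r d & forall h, nm h <= d -> G 0%N h = f h.
Proof.
move=> M0 r0 d0 tF Ff.
have h00 : nm 0 <= d by rewrite nm0 ltW.
have lims n : exists g : C -> C, forall h, nm h <= d -> (fun N => F N n h) @ \oo --> g h.
  elim: n => [|n [g gP]]; first by exists f.
  have gnz h : nm h <= d -> h != 0 -> (fun N => F N n.+1 h) @ \oo --> (g h - g 0) / h.
    move=> hd hn0.
    have -> : (fun N => F N n.+1 h) = (fun N => (F N n h - F N n 0) / h).
      apply/funext => N; have [-> _] := tF N n h hd.
      by rewrite addrAC subrr add0r mulrAC mulfV // mul1r.
    by apply: cvgM; [apply: cvgB; exact: gP|exact: cvg_cst].
  have [l Fl] : exists l : C, (fun N => F N n.+1 0) @ \oo --> l.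
    apply: nm_cauchy_cvg => e e0.
    pose K := M * r ^+ n.+2 + 1.
    have K0 : 0 < K by rewrite ltr_wpDl // mulr_ge0 // exprn_ge0.
    pose t := Num.min d (e / (4 * K)).
    have t0 : 0 < t by rewrite lt_min d0 divr_gt0 // mulr_gt0.
    pose h : C := real_complex R t.
    have hn : nm h = t by rewrite nm_pos // ltW.
    have hd : nm h <= d by rewrite hn ge_min lexx.
    have hn0 : h != 0 by rewrite -nm_gt0 hn.
    have := gnz h hd hn0; move/cvg_nmP/cvgrPdist_lt => /(_ (e / 8)) [|N _ NP].
      by rewrite divr_gt0.
    exists N => m Nm.
    have := NP N (leqnn N); have := NP m Nm.
    rewrite !sub0r !normrN !ger0_norm ?nm_ge0 //.
    move: (((g h - g 0) / h)) => a am aN.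
    have near0 k : nm (F k n.+1 0 - F k n.+1 h) <= e / 4.
      have [-> _] := tF k n.+1 h hd.
      rewrite opprD addrA subrr sub0r nmN nmM hn.
      have [_ b] := tF k n.+2 h hd.
      apply: (@le_trans _ _ (t * K)).
        by rewrite ler_wpM2l ?(ltW t0) //; apply: le_trans b _; rewrite lerDl.
      apply: (@le_trans _ _ (e / (4 * K) * K)).
        by rewrite ler_wpM2r ?(ltW K0) // ge_min lexx orbT.
      by rewrite le_eqVlt; apply/orP; left; apply/eqP; field; exact: lt0r_neq0.
    have := nm_dist (F m n.+1 0) (F N n.+1 0) (F m n.+1 h).
    have := nm_dist (F m n.+1 h) (F N n.+1 0) a.
    have := nm_dist a (F N n.+1 0) (F N n.+1 h).
    have := near0 m; have := near0 N.
    rewrite (nmBC (F N n.+1 0)) (nmBC a (F N n.+1 h)).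
    by move=> *; lra.
  exists (fun h => if h == 0 then l else (g h - g 0) / h) => h hd.
  by case: eqP => [->//|/eqP]; exact: gnz.
have {lims} [G GP] : exists G : nat -> C -> C, forall n h, nm h <= d -> (fun N => F N n h) @ \oo --> G n h.
  by have [G GP] := choice lims; exists G.
exists G; last first.
  by move=> h hd; apply: (cvg_unique _ (GP 0%N h hd) (Ff h hd)); exact: norm_hausdorff.
move=> n h hd; split.
  have e1 : (fun N => F N n h) @ \oo --> G n 0 + h * G n.+1 h.
    have -> : (fun N => F N n h) = (fun N => F N n 0 + h * F N n.+1 h).
      by apply/funext => N; have [] := tF N n h hd.
    apply: cvgD; first exact: GP.
    by apply: cvgM; [exact: cvg_cst|exact: GP].
  by apply: (cvg_unique _ (GP n h hd) e1); exact: norm_hausdorff.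
by apply: (nm_le_lim (GP n h hd)) => N; have [] := tF N n h hd.
Qed.

(** A local form of analyticity; [analytic_holo] derives it from power series. *)
Definition holo f z := exists F M r d,
  [/\ 0 <= M, 0 < r, 0 < d, tower F M r d & forall h, nm h <= d -> F 0%N h = f (z + h)].

Lemma holo_common f g z : holo f z -> holo g z ->
  exists F G M r d, [/\ 0 <= M, 0 < r & 0 < d] /\
   [/\ tower F M r d, tower G M r d, forall h, nm h <= d -> F 0%N h = f (z + h)
     & forall h, nm h <= d -> G 0%N h = g (z + h)].
Proof.
move=> [F [M [r [d [M0 r0 d0 tF Ff]]]]] [G [M' [r' [d' [M'0 r'0 d'0 tG Gg]]]]].
exists F, G, (Num.max M M'), (Num.max r r'), (Num.min d d').
split; first by split; rewrite ?le_max ?lt_max ?lt_min ?M0 ?r0 ?d0.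
split.
- by apply: (tower_weaken _ M0 (ltW r0) _ _ tF); rewrite ?le_max ?ge_min lexx.
- by apply: (tower_weaken _ M'0 (ltW r'0) _ _ tG); rewrite ?le_max ?ge_min lexx ?orbT.
- by move=> h; rewrite le_min => /andP[hd _]; exact: Ff.
- by move=> h; rewrite le_min => /andP[_ hd]; exact: Gg.
Qed.

Lemma holo_add f g z : holo f z -> holo g z -> holo (fun y => f y + g y) z.
Proof.
move=> hf hg; have [F [G [M [r [d [[M0 r0 d0] [tF tG Ff Gg]]]]]]] := holo_common hf hg.
exists (fun n h => F n h + G n h), (M + M), r, d; split=> //.
- by rewrite addr_ge0.
- exact: tower_add.
- by move=> h hd; rewrite Ff // Gg.
Qed.

Lemma holo_mul f g z : holo f z -> holo g z -> holo (fun y => f y * g y) z.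
Proof.
move=> hf hg; have [F [G [M [r [d [[M0 r0 d0] [tF tG Ff Gg]]]]]]] := holo_common hf hg.
exists (mul_tower F G), (2 * M * M), (2 * r), d; split=> //.
- by rewrite !mulr_ge0.
- by rewrite mulr_gt0.
- apply: tower_mul => //; try exact: ltW.
  by apply: (tower_weaken _ M0 (ltW r0) _ _ tG); rewrite ?lexx //; lra.
- by move=> h hd; rewrite /mul_tower big_geq // add0r Ff // Gg.
Qed.

Lemma holo_cst (c : C) z : holo (fun=> c) z.
Proof.
exists (fun n _ => if n is 0 then c else 0), (nm c), 1, 1; split=> //.
  exact: nm_ge0.
exact: tower_cst.
Qed.

Lemma holo_id z : holo (fun y => y) z.
Proof.
exists (fun n h => match n with 0 => z + h | 1 => 1 | _ => 0 end), (nm z + 1), 1, 1.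
split=> //; first by rewrite addr_ge0 ?nm_ge0.
move=> n h h1; rewrite expr1n mulr1; have z0 := nm_ge0 z.
case: n => [|[|n]]; split; rewrite ?mulr1 ?addr0 ?mulr0 ?addr0 ?nm1 ?nm0 //; try lra.
by apply: le_trans (nmD _ _) _; lra.
Qed.

Lemma holo_inv z : z != 0 -> holo (fun y => y^-1) z.
Proof.
move=> z0; have nz : 0 < nm z by rewrite nm_gt0.
exists (fun n h => (- z^-1) ^+ n / (z + h)), (2 / nm z), (nm z)^-1, (nm z / 2).
split; rewrite ?divr_ge0 ?invr_gt0 ?divr_gt0 ?(ltW nz) //; last by move=> h; rewrite expr0 mul1r.
move=> n h hd.
have zh : nm z / 2 <= nm (z + h) by have := nm_lowerD z h; lra.
have zh0 : z + h != 0 by rewrite -nm_gt0; lra.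
split.
  by rewrite exprS; field; rewrite zh0 z0.
rewrite nmM nmX nmN !nmV mulrC ler_wpM2r ?exprn_ge0 ?invr_ge0 ?nm_ge0 //.
rewrite -[2 / _]invf_div lef_pV2 // posrE ?nm_gt0 //; lra.
Qed.

Lemma holo_opp f z : holo f z -> holo (fun y => - f y) z.
Proof.
move=> hf; have := holo_mul (holo_cst (-1) z) hf; congr holo.
by apply/funext => y; rewrite mulN1r.
Qed.

Lemma holo_sub f g z : holo f z -> holo g z -> holo (fun y => f y - g y) z.
Proof. by move=> hf hg; apply: holo_add => //; exact: holo_opp. Qed.

Lemma holo_scale (c : C) f z : holo f z -> holo (fun y => c * f y) z.
Proof. by move=> hf; apply: holo_mul => //; exact: holo_cst. Qed.

Lemma holo_sum I (s : seq I) (f : I -> C -> C) z : (forall i, holo (f i) z) ->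
  holo (fun y => \sum_(i <- s) f i y) z.
Proof.
move=> hf; elim: s => [|i s IH].
  by have := holo_cst 0 z; congr holo; apply/funext => y; rewrite big_nil.
have := holo_add (hf i) IH; congr holo.
by apply/funext => y; rewrite big_cons.
Qed.

Lemma holo_prod I (s : seq I) (P : pred I) (f : I -> C -> C) z : (forall i, holo (f i) z) ->
  holo (fun y => \prod_(i <- s | P i) f i y) z.
Proof.
move=> hf; elim: s => [|i s IH].
  by have := holo_cst 1 z; congr holo; apply/funext => y; rewrite big_nil.
have h : holo (fun y => (if P i then f i y else 1) * \prod_(j <- s | P j) f j y) z.
  apply: holo_mul; last exact: IH.
    by case: (P i); [exact: hf|exact: holo_cst].
move: h; congr holo; apply/funext => y; rewrite big_cons; case: (P i) => //.
by rewrite mul1r.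
Qed.

Lemma holo_exp f z n : holo f z -> holo (fun y => f y ^+ n) z.
Proof.
move=> hf; elim: n => [|n IH].
  by have := holo_cst 1 z; congr holo; apply/funext => y; rewrite expr0.
by have := holo_mul hf IH; congr holo; apply/funext => y; rewrite exprS.
Qed.

(** The partial products are towers whose bounds are controlled by a convergent
real product, so that [tower_lim] applies. *)
Lemma holo_qpoch_inf (q : C) g z : nm q < 1 -> holo g z ->
  holo (fun y => qpoch_inf q (g y)) z.
Proof.
move=> q1 [G [M [r [d [M0 r0 d0 tG Gg]]]]].
pose P := fix P N n h : C := if N is N'.+1 then
   P N' n h - mul_tower (fun n h => q ^+ N' * G n h) (P N') n h else
   if n is 0 then 1 else 0.
have P0 N h : nm h <= d -> P N 0%N h = \prod_(k < N) (1 - g (z + h) * q ^+ k).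
  move=> hd; elim: N => [|N IH]; first by rewrite big_ord0.
  rewrite /= /mul_tower big_geq // add0r big_ord_recr /= -IH Gg //; ring.
have tP N : tower (P N) (\prod_(0 <= k < N) (1 + (2 * M) * nm q ^+ k)) (2 * r) d.
  elim: N => [|N IH].
    have r20 : 0 <= 2 * r by rewrite mulr_ge0 // ltW.
    by have := @tower_cst 1 _ d r20; rewrite nm1 big_geq.
  rewrite big_nat_recr //=.
  set B := \prod_(0 <= k < N) _ in IH *.
  have B0 : 0 <= B.
    by apply: prodr_ge0 => k _; rewrite addr_ge0 // !mulr_ge0 // exprn_ge0 // nm_ge0.
  have -> : B * (1 + 2 * M * nm q ^+ N) = B + 2 * (nm (q ^+ N) * M) * B.
    by rewrite nmX; ring.
  apply: tower_add => //; apply: tower_opp; apply: tower_mul => //.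
  - by rewrite mulr_ge0 // nm_ge0.
  - exact: ltW.
  - exact: ltW.
  - exact: tower_scale.
pose B := expR (2 * M / (1 - nm q)).
have [H tH Hf] : exists2 H, tower H B (2 * r) d
    & forall h, nm h <= d -> H 0%N h = qpoch_inf q (g (z + h)).
  apply: (@tower_lim P) => //.
  - exact: expR_ge0.
  - by rewrite mulr_ge0 // ltW.
  - move=> N; apply: (tower_weaken _ _ _ _ _ (tP N)) => //.
    + by apply: prod_exp_le => //; rewrite ?mulr_ge0 ?nm_ge0.
    + by apply: prodr_ge0 => k _; rewrite addr_ge0 // !mulr_ge0 // exprn_ge0 // nm_ge0.
    + by rewrite mulr_ge0 // ltW.
  - move=> h hd; under eq_fun do rewrite P0 //; exact: qpoch_inf_cvg.
exists H, B, (2 * r), d; split=> //; first exact: expR_ge0.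
by rewrite mulr_gt0.
Qed.

(** The partial sums of a power series are towers with common constants on a
smaller disc. *)
Lemma analytic_holo f z : analytic_at f z -> holo f z.
Proof.
move=> [c [e [e0 ec]]].
have [t t0 et] : exists2 t : R, 0 < t & forall h, nm h < t ->
    series (fun m => c m * h ^+ m) @ \oo --> f (z + h).
  move: (e0); rewrite ltcE => /andP[/= /eqP ei er].
  exists (complex.Re e) => // h ht; apply: ec; rewrite normE.
  by case: e ei er ht {e0} => a b /= -> _ ht; rewrite ltcR.
have [M M0 Mc] : exists2 M : R, 0 <= M & forall m, nm (c m) <= M * (2 / t) ^+ m.
  pose h : C := real_complex R (t / 2).
  have hn : nm h = t / 2 by rewrite nm_pos // divr_ge0 // ltW.
  have hcv : cvgn (series (fun m => c m * h ^+ m)).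
    apply/cvg_ex; eexists; apply: et; rewrite hn; lra.
  have /cvg_nm := cvg_series_cvg_0 hcv; rewrite nm0 => c0.
  have /cvg_seq_bounded[B [_ BP]] : cvgn (fun m => nm (c m * h ^+ m)).
    by apply/cvg_ex; eexists; exact: c0.
  have {}BP m : nm (c m * h ^+ m) <= `|B| + 1.
    apply: le_trans (ler_norm _) _; apply: (BP (`|B| + 1)) => //.
    by apply: le_lt_trans (ler_norm _) _; rewrite ltrDl.
  exists (`|B| + 1); first by rewrite addr_ge0.
  move=> m; have := BP m; rewrite nmM nmX hn -[2 / t]invf_div exprVn => cm.
  by rewrite ler_pdivlMr // exprn_gt0 // divr_gt0.
pose F N n h : C := \sum_(0 <= m < N - n) c (n + m)%N * h ^+ m.
have r0 : 0 < 2 / t by rewrite divr_gt0.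
have tF N : tower (F N) (2 * M) (2 / t) (t / 4).
  move=> n h hd; rewrite /F; split.
    case: (leqP N n) => [Nn|nN].
      by rewrite subnS; move: Nn; rewrite -subn_eq0 => /eqP ->; rewrite !big_geq // mulr0 addr0.
    have -> : (N - n = (N - n.+1).+1)%N by rewrite subnS prednK // subn_gt0.
    rewrite !big_nat_recl //= !expr0.
    have -> : \sum_(0 <= i < N - n.+1) c (n + i.+1)%N * 0 ^+ i.+1 = 0.
      by rewrite big1 // => i _; rewrite exprS mul0r mulr0.
    rewrite addr0.
    rewrite mulr_sumr; congr (_ + _); apply: eq_bigr => i _.
    by rewrite addnS addSn exprS; ring.
  apply: le_trans (nm_sum _ _ _) _.
  apply: (@le_trans _ _ (\sum_(0 <= m < N - n) M * (2 / t) ^+ n * 2^-1 ^+ m)).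
    apply: ler_sum => m _; rewrite nmM nmX.
    apply: (@le_trans _ _ (M * (2 / t) ^+ (n + m) * (t / 4) ^+ m)).
      by apply: ler_pM => //; rewrite ?nm_ge0 ?exprn_ge0 ?nm_ge0 // lerXn2r ?nnegrE ?nm_ge0 //; lra.
    rewrite exprD -!mulrA -exprMn; have -> // : 2 / t * (t / 4) = 2^-1 by field; exact: lt0r_neq0.
  rewrite -mulr_sumr.
  have : \sum_(0 <= m < N - n) 1 * 2^-1 ^+ m <= 2 :> R.
    have e2 : 1 * 2^-1 ^+ 0 / (1 - 2^-1) = 2 :> R by rewrite expr0; field.
    by rewrite -[leRHS]e2; apply: geom_sum_le => //; lra.
  under eq_bigr do rewrite mul1r.
  have q0 : 0 <= M * (2 / t) ^+ n by rewrite mulr_ge0 // exprn_ge0 // ltW.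
  move: q0; move: ((2 / t) ^+ n) (\sum_(0 <= m < _) _) => x S; nra.
have d0 : 0 < t / 4 by rewrite divr_gt0.
have M20 : 0 <= 2 * M by rewrite mulr_ge0.
have [h|G tG Gf] := @tower_lim F (fun h => f (z + h)) _ _ _ M20 (ltW r0) d0 tF.
  move=> hd; have : series (fun m => c m * h ^+ m) @ \oo --> f (z + h) by apply: et; lra.
  apply: cvg_trans; apply: near_eq_cvg; near=> N.
  by rewrite /F subn0 /series /=.
by exists G, (2 * M), (2 / t), (t / 4).
Unshelve. all: by end_near. Qed.

End DifferenceTowers.

(** * Order of vanishing and the identity theorem *)

Section LocalTheory.
Variable R : realType.
Local Notation C := (Cplx R).
Local Notation nm := (@modulus R).
Implicit Types (f g Q : C -> C) (z w : C).

Lemma holo_slope f z : holo f z ->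
  exists2 G : C -> C, G @ z --> G z & \forall y \near z, f y = f z + (y - z) * G y.
Proof.
move=> [F [M [r [d [M0 r0 d0 tF Ff]]]]]; have h00 : nm 0 <= d by rewrite nm0 ltW.
exists (fun y => F 1%N (y - z)); last first.
  apply/near_nmP; exists d => // y /ltW yd.
  have [e _] := tF 0%N (y - z) yd.
  by rewrite (Ff _ yd) (Ff _ h00) addr0 addrC subrK in e.
apply/cvg_atP => e e0.
pose K := M * r ^+ 2 + 1.
have K0 : 0 < K by rewrite ltr_wpDl // mulr_ge0 // exprn_ge0 // ltW.
exists (Num.min d (e / K)); first by rewrite lt_min d0 divr_gt0.
move=> y; rewrite lt_min => /andP[/ltW yd ye].
rewrite subrr.
have [-> _] := tF 1%N (y - z) yd; rewrite addrAC subrr add0r nmM.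
have [_ b] := tF 2%N (y - z) yd.
apply: le_lt_trans (_ : nm (y - z) * K < e); last by rewrite -ltr_pdivlMr.
by rewrite ler_wpM2l ?nm_ge0 //; apply: le_trans b _; rewrite lerDl.
Qed.

Lemma holo_cvg f z : holo f z -> f @ z --> f z.
Proof.
move=> /holo_slope[G Gc fG].
have : (fun y => f z + (y - z) * G y) @ z --> f z + (z - z) * G z.
  have h1 := at_sub (@at_id _ z) (@at_cst _ z z).
  have h2 := at_mul h1 Gc.
  by apply: at_add h2; exact: at_cst.
rewrite subrr mul0r addr0; apply: at_eq.
by apply: filterS fG => y ->.
Qed.

(** If all Taylor coefficients vanish then |f| <= M (r |h|)^n for every n; else
the first nonzero one is the value of the cofactor. *)
Lemma holo_order f z : holo f z ->
  (\forall y \near z, f y = 0) \/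
  exists k (G : C -> C), [/\ G @ z --> G z, G z != 0 &
     \forall y \near z, f y = (y - z) ^+ k * G y].
Proof.
move=> [F [M [r [d [M0 r0 d0 tF Ff]]]]]; have h00 : nm 0 <= d by rewrite nm0 ltW.
have [all0|] := pselect (forall n, F n 0 = 0).
  left; apply/near_nmP; exists (Num.min d (1 / (2 * r))).
    by rewrite lt_min d0 divr_gt0 // mulr_gt0.
  move=> y; rewrite lt_min => /andP[/ltW yd yr].
  have Fn n : f y = (y - z) ^+ n * F n (y - z).
    elim: n => [|n ->]; first by rewrite expr0 mul1r Ff // addrC subrK.
    by have [-> _] := tF n _ yd; rewrite all0 add0r exprSr mulrA.
  apply/eqP; rewrite -nm_eq0; apply/eqP/le_anti; rewrite nm_ge0 andbT.
  have b n : nm (f y) <= M * 2^-1 ^+ n.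
    rewrite (Fn n) nmM nmX; have [_ bF] := tF n _ yd.
    apply: (@le_trans _ _ (nm (y - z) ^+ n * (M * r ^+ n))).
      by rewrite ler_wpM2l ?exprn_ge0 ?nm_ge0.
    have hr : nm (y - z) * r <= 2^-1 by move: yr; rewrite ltr_pdivlMr ?mulr_gt0 //; lra.
    rewrite mulrCA -exprMn ler_wpM2l //; apply: lerXn2r => //.
    - by rewrite nnegrE mulr_ge0 ?nm_ge0 // ltW.
    - by rewrite nnegrE invr_ge0.
  have c : (fun n => M * 2^-1 ^+ n) @ \oo --> (0 : R).
    rewrite -(mulr0 M); apply: cvgM; first exact: cvg_cst.
    by apply: cvg_expr; rewrite ger0_norm //; lra.
  rewrite -[leRHS](cvg_lim (@Rhausdorff R) c); apply: limr_ge.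
    by apply/cvg_ex; eexists; exact: c.
  by near=> n; exact: b.
move=> /existsNP => -[n0 Fn0]; right.
have exF : exists n, F n 0 != 0 by exists n0; apply/eqP.
case: (ex_minnP exF) => k Fk kmin.
have Fk0 n : (n < k)%N -> F n 0 = 0.
  by move=> nk; apply/eqP; apply: contraTT nk => /kmin; rewrite leqNgt.
have key n y : (n <= k)%N -> nm (y - z) <= d -> f y = (y - z) ^+ n * F n (y - z).
  move=> + yd; elim: n => [_|n IH nk]; first by rewrite expr0 mul1r Ff // addrC subrK.
  rewrite (IH (ltnW nk)).
  by have [-> _] := tF n _ yd; rewrite Fk0 // add0r exprSr mulrA.
exists k, (fun y => F k (y - z)); split.
- apply/cvg_atP => e e0.
  pose K := M * r ^+ k.+1 + 1.
  have K0 : 0 < K by rewrite ltr_wpDl // mulr_ge0 // exprn_ge0 // ltW.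
  exists (Num.min d (e / K)); first by rewrite lt_min d0 divr_gt0.
  move=> y; rewrite lt_min => /andP[/ltW yd ye].
  rewrite subrr.
  have [-> _] := tF k (y - z) yd; rewrite addrAC subrr add0r nmM.
  have [_ b] := tF k.+1 (y - z) yd.
  apply: le_lt_trans (_ : nm (y - z) * K < e); last by rewrite -ltr_pdivlMr.
  by rewrite ler_wpM2l ?nm_ge0 //; apply: le_trans b _; rewrite lerDl.
- by rewrite subrr.
- by apply/near_nmP; exists d => // y /ltW yd; exact: key.
Unshelve. all: by end_near. Qed.

Lemma near_neq0 (G : C -> C) z : G @ z --> G z -> G z != 0 ->
  \forall y \near z, G y != 0.
Proof.
move=> /cvg_atP Gc Gz; apply/near_nmP.
have [|d d0 dG] := Gc (nm (G z)); first by rewrite nm_gt0.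
exists d => // y /dG; apply: contraTneq => ->.
by rewrite sub0r nmN ltxx.
Qed.

Lemma holo_isolated f z : holo f z ->
  (\forall y \near z, f y = 0) \/ (\forall y \near z, y != z -> f y != 0).
Proof.
move=> /holo_order[|[k [G [Gc Gz fG]]]]; first by left.
right; have G0 := near_neq0 Gc Gz; near=> y => yz.
rewrite (near fG y) //; first by rewrite mulf_neq0 ?expf_neq0 ?subr_eq0 //; near: y.
Unshelve. all: by end_near. Qed.

Lemma near_punctured z (P : C -> Prop) : (\forall y \near z, P y) ->
  exists2 y, y != z & P y.
Proof.
move=> /near_nmP[d d0 dP].
have d2 : 0 < d / 2 by rewrite divr_gt0.
have hn : nm (z + real_complex R (d / 2) - z) = d / 2.
  by rewrite addrAC subrr add0r nm_pos // ltW.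
exists (z + real_complex R (d / 2)); first by rewrite -subr_eq0 -nm_gt0 hn.
by apply: dP; rewrite hn; lra.
Qed.

Lemma near_near z (P : C -> Prop) : (\forall y \near z, P y) ->
  \forall y \near z, \forall w \near y, P w.
Proof.
move=> /near_nmP[d d0 dP]; apply/near_nmP; exists d => // y yd.
apply/near_nmP; exists (d - nm (y - z)); first by rewrite subr_gt0.
by move=> w wd; apply: dP; have := nm_dist w z y; lra.
Qed.

Definition segment_point z w (t : R) : C := z + real_complex R t * (w - z).

Lemma near_segment z w t (P : C -> Prop) : (\forall y \near segment_point z w t, P y) ->
  \forall s \near t, P (segment_point z w s).
Proof.
move=> /near_nmP[e e0 eP]; pose K := nm (w - z) + 1.
have K0 : 0 < K by rewrite ltr_wpDl ?nm_ge0.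
apply/nbhs_ballP; exists (e / K) => /=; first by rewrite divr_gt0.
move=> s; rewrite /ball /= => st; apply: eP.
rewrite /segment_point opprD addrACA subrr add0r -mulrBl nmM.
rewrite -(rmorphB (real_complex R)) nm_real distrC.
apply: le_lt_trans (_ : `|t - s| * K < e); last by rewrite -ltr_pdivlMr.
by rewrite ler_wpM2l // lerDl.
Qed.

(** The parameters near which f vanishes form an open subset of [0, 1], closed
because zeros of a function that is not locally zero are isolated. *)
Lemma holo_segment f z w :
  (forall t : R, 0 <= t <= 1 -> holo f (segment_point z w t)) ->
  (\forall y \near z, f y = 0) -> \forall y \near w, f y = 0.
Proof.
move=> hf fz.
have [->//|zw] := eqVneq w z.
pose Z := [set t | \forall y \near segment_point z w t, f y = 0].
have oZ : open Z.
  rewrite openE => t /near_near Zt; exact: (near_segment Zt).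
pose B := `[0, 1]%classic `&` Z : set R.
have s0 : segment_point z w 0 = z by rewrite /segment_point mul0r addr0.
have s1 : segment_point z w 1 = w by rewrite /segment_point mul1r addrC subrK.
have sI t t' : segment_point z w t = segment_point z w t' -> t = t'.
  move=> /addrI/mulIf; rewrite subr_eq0 => /(_ zw) /eqP.
  by move=> /eqP/complexI.
have BE : B = `[0, 1]%classic.
  apply: (@segment_connected R 0 1).
  - exists 0; split; first by rewrite /= in_itv /= lexx ler01.
    by rewrite /Z /mkset s0.
  - by exists Z.
  - exists (closure B); first exact: closed_closure.
    apply/seteqP; split => t; first by move=> Bt; split; [case: Bt|exact: subset_closure].
    move=> [t01 clt]; split; first exact: t01.
    have hft : holo f (segment_point z w t) by apply: hf; move: t01; rewrite /= in_itv.
    case: (holo_isolated hft) => [zt|nz]; first exact: zt.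
    have [s [[s01 Zs] fs]] := clt _ (near_segment nz).
    have [st|st] := eqVneq (segment_point z w s) (segment_point z w t).
      by rewrite -(sI _ _ st).
    by exfalso; case/negP: (fs st); apply/eqP; exact: (nbhs_singleton Zs).
have [_] : B 1 by rewrite BE /= in_itv /= ler01 lexx.
by rewrite /Z /mkset s1.
Qed.

Definition holo_off0 f := forall z, z != 0 -> holo f z.

(** Two points of the punctured plane are joined by a segment avoiding 0, except
when one is a negative multiple of the other; a detour through a quarter turn
then works. *)
Lemma holo_identity f z w : holo_off0 f -> z != 0 -> w != 0 ->
  (\forall y \near z, f y = 0) -> \forall y \near w, f y = 0.
Proof.
move=> hf.
have seg z' w' : (forall t : R, 0 <= t <= 1 -> segment_point z' w' t != 0) ->
    (\forall y \near z', f y = 0) -> \forall y \near w', f y = 0.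
  by move=> s0; apply: holo_segment => t t01; apply: hf; exact: s0.
move=> z0 w0 fz.
have [allt|] := pselect (forall t : R, 0 <= t <= 1 -> segment_point z w t != 0).
  exact: seg fz.
move=> /existsNP[t /not_implyP[t01 /negP/negPn/eqP st]].
(* the segment meets 0, so that w is a negative multiple of z *)
have [b b0 wE] : exists2 b : R, 0 <= b & w = - (real_complex R b) * z.
  have t0 : t != 0.
    by apply: contra_neq z0 => t0; move: st; rewrite /segment_point t0 mul0r addr0.
  have tC0 : real_complex R t != 0 by rewrite (inj_eq (@complexI R)).
  exists ((1 - t) / t).
    by case/andP: t01 => t0' t1; rewrite divr_ge0 // subr_ge0.
  apply: (mulfI tC0); rewrite mulrA mulrN -(rmorphM (real_complex R)).
  have -> : t * ((1 - t) / t) = 1 - t by field.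
  rewrite rmorphB /=.
  have -> : real_complex R t * w = segment_point z w t - (1 - real_complex R t) * z.
    by rewrite /segment_point; ring.
  by rewrite st sub0r mulNr.
pose i : C := 'i%C.
have pt (x y : R) : (x != 0) || (y != 0) -> (real_complex R x + real_complex R y * i) * z != 0.
  move=> xy; rewrite mulf_neq0 //.
  have -> : real_complex R x + real_complex R y * i = (x +i* y)%C.
    by apply/eqP; rewrite eq_complex /=; apply/andP; split; apply/eqP => /=; ring.
  by rewrite eq_complex /= negb_and.
apply: (seg (i * z)); last apply: seg fz => t' _.
- move=> t' _; have -> : segment_point (i * z) w t' =
      (real_complex R (- (t' * b)) + real_complex R (1 - t') * i) * z.
    rewrite /segment_point wE rmorphN rmorphM rmorphB /=; ring.
  apply: pt; rewrite oppr_eq0 mulf_eq0 negb_or subr_eq0 [1 == _]eq_sym.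
  have [->|] := eqVneq t' 1; last by rewrite orbT.
  rewrite orbF oner_eq0 /=; apply: contra_neq w0 => b00.
  by rewrite wE b00 oppr0 mul0r.
- have -> : segment_point z (i * z) t' =
      (real_complex R (1 - t') + real_complex R t' * i) * z.
    rewrite /segment_point rmorphB /=; ring.
  apply: pt; have [->|] := eqVneq t' 0; last by rewrite orbT.
  by rewrite subr0 oner_eq0.
Qed.

End LocalTheory.

(** * Maximum modulus and rigidity of quasi-periodic functions *)

Section Rigidity.
Variable R : realType.
Local Notation C := (Cplx R).
Local Notation nm := (@modulus R).
Implicit Types (f g Q : C -> C) (z w : C).

(** A closed subset of the continuous image of a compact square. *)
Lemma compact_annulus (a b : R) : compact [set z : C | a <= nm z <= b].
Proof.
pose phi (p : R * R) : C := (p.1 +i* p.2)%C.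
have phic : continuous phi.
  move=> p P /near_nmP[e e0 eP]; apply/nbhs_ballP.
  exists (e / 2) => /=; first by rewrite divr_gt0.
  move=> [x y] [/= bx by_]; apply: eP; apply: le_lt_trans (nm_ReIm _) _.
  rewrite /ball /= in bx by_; rewrite /= [`|x - _|]distrC [`|y - _|]distrC; lra.
pose B := phi @` (`[- b, b] `*` `[- b, b]).
have cB : compact B.
  apply: continuous_compact; first exact: continuous_subspaceT.
  by apply: compact_setX; exact: segment_compact.
apply: (subclosed_compact _ cB).
  have -> : [set z : C | a <= nm z <= b] = nm @^-1` `[a, b]%classic.
    by apply/seteqP; split => z /=; rewrite in_itv.
  apply: closed_comp; last exact: itv_closed.
  move=> z _ P /nbhs_ballP[e /= e0 eP]; apply/near_nmP; exists e => // y ye.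
  apply: eP; rewrite /ball /= ltr_norml; apply/andP; split.
    by rewrite ltrNl opprB; apply: le_lt_trans ye; exact: nm_lower.
  by apply: le_lt_trans ye; rewrite nmBC; exact: nm_lower.
move=> z /= /andP[_ zb]; exists (complex.Re z, complex.Im z); last by case: z {zb}.
split=> /=; rewrite in_itv /= -ler_norml; apply: le_trans zb.
  exact: Re_le_nm.
exact: Im_le_nm.
Qed.

Lemma compact_uniform (K : set C) (P : nat -> C -> Prop) : compact K ->
  (forall m n z, (m <= n)%N -> P m z -> P n z) ->
  (forall z, K z -> exists n, \forall y \near z, P n y) ->
  exists n, forall z, K z -> P n z.
Proof.
move=> /compact_near_coveringP cK Pmon loc.
have [N _ NP] : \forall n \near \oo, K `<=` P n.
  apply: cK => z Kz; have [n nP] := loc z Kz.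
  exists ([set y | P n y], [set m | (n <= m)%N]) => /=; first by split=> //; exists n.
  by move=> [y m] /= [Py nm_]; exact: Pmon Py.
by exists N => z; exact: (NP N (leqnn N)).
Qed.

(** The maximum modulus principle for the quotient f / Q, without dividing: [c]
is the value of the quotient at [z].  If f - c Q is not locally zero it equals
h^j (gamma + o(1)) Q with j >= 1, and when |c| >= M > 0 a suitable direction
of h makes |f| exceed M |Q|. *)
Lemma max_modulus f Q z (c : C) (M : R) : holo f z -> holo Q z ->
  ~ (\forall y \near z, Q y = 0) ->
  (forall e : R, 0 < e -> \forall y \near z, nm (f y - c * Q y) <= e * nm (Q y)) ->
  0 < M -> (\forall y \near z, nm (f y) <= M * nm (Q y)) ->
  (\forall y \near z, f y = c * Q y) \/ nm c < M.
Proof.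
move=> hf hQ Qn0 fc M0 fM.
have [|[l [G [Gc Gz gG]]]] := holo_order (holo_sub hf (holo_scale c hQ)).
  by move=> fQ; left; apply: filterS fQ => y /eqP; rewrite subr_eq0 => /eqP.
have [//|[k [P [Pc Pz QP]]]] := holo_order hQ.
right; rewrite ltNge; apply/negP => cM.
have c0 : c != 0 by rewrite -nm_gt0 (lt_le_trans M0).
have Gn0 := near_neq0 Gc Gz; have Pn0 := near_neq0 Pc Pz.
have ratio : (fun y => G y / P y) @ z --> G z / P z.
  have Pi := at_inv Pz Pc; exact: (at_mul Gc Pi).
have [gam gamE] : exists gam, gam = G z / P z by exists (G z / P z).
rewrite -gamE in ratio.
have gam0 : gam != 0 by rewrite gamE mulf_neq0 // invr_eq0.
(* f - c Q vanishes to higher order than Q, since f / Q tends to c. *)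
have kl : (k < l)%N.
  rewrite ltnNge; apply/negP => lk.
  have := fc (nm gam / 2); rewrite divr_gt0 ?nm_gt0 // => /(_ isT) fe.
  have /cvg_atP/(_ (nm gam / 2)) := ratio.
  rewrite divr_gt0 ?nm_gt0 // => /(_ isT) [d d0 dr].
  have nd : \forall y \near z, nm (y - z) < Num.min d 1.
    by apply/near_nmP; exists (Num.min d 1); rewrite // lt_min d0 ltr01.
  have /near_punctured[y yz [fy gy Qy Py /andP[yd y1]]] : \forall y \near z,
    [/\ nm (f y - c * Q y) <= nm gam / 2 * nm (Q y), f y - c * Q y = (y - z) ^+ l * G y,
        Q y = (y - z) ^+ k * P y, P y != 0 & (nm (y - z) < d) && (nm (y - z) < 1)].
    near=> y; split; try by near: y.
    by rewrite -lt_min; near: y.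
  have := dr _ yd => near_gam.
  move: fy; rewrite gy Qy !nmM !nmX.
  have yz0 : 0 < nm (y - z) by rewrite nm_gt0 subr_eq0.
  have -> : nm (y - z) ^+ k = nm (y - z) ^+ l * nm (y - z) ^+ (k - l).
    by rewrite -exprD subnKC.
  rewrite -(mulrA (_ ^+ l)) [leRHS]mulrCA ler_pM2l ?exprn_gt0 //.
  have -> : nm (G y) = nm (G y / P y) * nm (P y).
    by rewrite nmf_div mulfVK // gt_eqF // nm_gt0.
  rewrite mulrA ler_pM2r ?nm_gt0 //.
  have : nm gam / 2 * nm (y - z) ^+ (k - l) <= nm gam / 2.
    by rewrite ler_piMr ?divr_ge0 ?nm_ge0 // exprn_ile1 ?nm_ge0 // ltW.
  have := nm_lower gam (gam - G y / P y); rewrite opprB addrCA subrr addr0.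
  by rewrite nmBC in near_gam; move=> *; lra.
pose j := (l - k)%N; have j0 : (0 < j)%N by rewrite subn_gt0.
(* Along h = t om the perturbation h^j gam = t^j c of c points outwards. *)
pose om : C := nthroot j (c / gam : R[i]).
have omj : om ^+ j * gam = c.
  have -> : om ^+ j = c / gam by exact: (@rootCK R[i]).
  by rewrite mulfVK.
have om0 : om != 0 by apply: contra_neq c0 => o; rewrite -omj o expr0n eqn0Ngt j0 mul0r.
have /cvg_atP/(_ (nm gam / 2)) := ratio.
rewrite divr_gt0 ?nm_gt0 // => /(_ isT) [d d0 dr].
have nd : \forall y \near z, nm (y - z) < d by apply/near_nmP; exists d.
have /near_nmP[d' d'0 all_near] : \forall y \near z,
    [/\ nm (f y) <= M * nm (Q y), f y - c * Q y = (y - z) ^+ l * G y,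
        Q y = (y - z) ^+ k * P y, P y != 0 & nm (y - z) < d].
  by near=> y; split; near: y.
pose t := d' / (2 * nm om).
have t0 : 0 < t by rewrite divr_gt0 // mulr_gt0 // nm_gt0.
pose h : C := real_complex R t * om.
have hn : nm h = d' / 2.
  by rewrite nmM nm_pos ?(ltW t0) // /t; field; rewrite nm_eq0.
have h0 : h != 0 by rewrite -nm_gt0 hn divr_gt0.
have hz : z + h - z = h by rewrite addrAC subrr add0r.
have [|fy gy Qy Py yd] := all_near (z + h); first by rewrite hz hn; lra.
have := dr _ yd; move: gy Qy; rewrite !hz.
set Gy := G (z + h); set u := Gy / P (z + h) => gy Qy near_gam.
have Qy0 : Q (z + h) != 0 by rewrite Qy mulf_neq0 // expf_neq0.
have fE : f (z + h) = (c * (1 + real_complex R (t ^+ j)) + h ^+ j * (u - gam)) * Q (z + h).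
  have e1 : f (z + h) = c * Q (z + h) + h ^+ j * u * Q (z + h).
    rewrite -[LHS](subrK (c * Q (z + h))) gy addrC; congr (_ + _).
    rewrite Qy /u -{1}(subnK (ltnW kl)) -/j exprD; field; exact: Py.
  have e2 : h ^+ j * gam = c * real_complex R (t ^+ j).
    by rewrite /h exprMn -mulrA omj mulrC rmorphXn.
  by rewrite e1 mulrBr e2; ring.
move: fy; rewrite fE nmM ler_pM2r ?nm_gt0 // leNgt => /negP; apply.
apply: le_lt_trans cM _; apply: lt_le_trans (nm_lowerD _ _).
have tj0 : 0 < t ^+ j by rewrite exprn_gt0.
have -> : nm (c * (1 + real_complex R (t ^+ j))) = nm c * (1 + t ^+ j).
  rewrite nmM; congr (_ * _); rewrite -(rmorph1 (real_complex R)) -rmorphD nm_pos //.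
  by rewrite addr_ge0 // ltW.
have -> : nm (h ^+ j * (u - gam)) = t ^+ j * (nm om ^+ j * nm (u - gam)).
  by rewrite nmM nmX nmM nm_pos ?(ltW t0) // exprMn mulrA.
have cE : nm c = nm om ^+ j * nm gam by rewrite -omj nmM nmX.
have : nm om ^+ j * nm (u - gam) < nm c.
  by rewrite cE ltr_pM2l ?exprn_gt0 ?nm_gt0 //; have := nm_ge0 gam; lra.
by move: (nm om ^+ j * _) tj0 => x; move: (t ^+ j) => s; nra.
Unshelve. all: by end_near. Qed.

Variable q : C.
Hypotheses (q0 : q != 0) (q1 : nm q < 1).

Let nq0 : 0 < nm q. Proof. by rewrite nm_gt0. Qed.

Lemma nm_q_small (x : R) : 0 < x -> exists k, nm q ^+ k < x.
Proof.
move=> x0; have : (fun k => nm q ^+ k) @ \oo --> (0 : R).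
  by apply: cvg_expr; rewrite ger0_norm ?nm_ge0.
move=> /cvgrPdist_lt/(_ _ x0) [k _ /(_ k (leqnn k))].
by rewrite sub0r normrN => /(le_lt_trans (ler_norm _)) h; exists k.
Qed.

Lemma q_window z : z != 0 -> exists n : int, 1 <= nm (q ^ n * z) < (nm q)^-1.
Proof.
move=> z0; have nz : 0 < nm z by rewrite nm_gt0.
have [z1|z1] := leP 1 (nm z).
  have ex : exists k, nm q ^+ k < (nm z)^-1 by apply: nm_q_small; rewrite invr_gt0.
  case: (ex_minnP ex) => -[|k].
    by rewrite expr0 invf_gt1 // ltNge z1.
  move=> kz kmin; exists k%:Z; rewrite nmM nmXz -exprnP.
  apply/andP; split.
    rewrite leNgt; apply/negP => h.
    have : nm q ^+ k < (nm z)^-1 by rewrite -(ltr_pM2r nz) mulVf // lt0r_neq0.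
    by move=> /kmin; rewrite ltnn.
  move: kz; rewrite exprS -(ltr_pM2r nz) mulVf ?lt0r_neq0 //.
  by rewrite -mulrA -ltr_pdivlMl // mulr1.
have ex : exists k, nm q ^+ k <= nm z.
  by have [k /ltW] := nm_q_small nz; exists k.
case: (ex_minnP ex) => -[|k]; first by rewrite expr0 leNgt z1.
move=> kz kmin; exists (- k.+1%:Z); rewrite nmM nmXz -exprnN.
apply/andP; split; first by rewrite mulrC ler_pdivlMr ?exprn_gt0 // mul1r.
have : nm z < nm q ^+ k.
  by rewrite ltNge; apply/negP => /kmin; rewrite ltnn.
rewrite mulrC ltr_pdivrMr ?exprn_gt0 // exprS mulrA mulVf ?mul1r //.
exact: lt0r_neq0.
Qed.

(** Local properties compatible with y -> q y need only be checked in a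
fundamental annulus. *)
Lemma q_invariant (P : C -> Prop) : (forall y, y != 0 -> P y <-> P (q * y)) ->
  forall (n : int) y, y != 0 -> P y <-> P (q ^ n * y).
Proof.
move=> Pq; have pos n y : y != 0 -> P y <-> P (q ^+ n * y).
  elim: n y => [|n IH] y y0; first by rewrite expr0 mul1r.
  rewrite exprS -mulrA (IH y y0); apply: Pq.
  by rewrite mulf_neq0 // expf_neq0.
case=> n y y0; first exact: pos.
rewrite NegzE -exprnN; have y'0 : (q ^+ n.+1)^-1 * y != 0.
  by rewrite mulf_neq0 // invr_eq0 expf_neq0.
rewrite (pos n.+1 _ y'0) mulrA mulfV ?mul1r // expf_neq0 //.
Qed.

(** Let M be the least bound for |f| / |Q|.  If at every point of the closed
fundamental annulus the local value of f / Q had modulus less than M,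
compactness would give a smaller bound.  So f = c Q near one of its points, by
[max_modulus], and everywhere by the identity theorem. *)
Lemma rigidity f Q (mu : C -> C) : holo_off0 f -> holo_off0 Q ->
  (forall y, y != 0 -> mu y != 0) ->
  (forall y, y != 0 -> f (q * y) = mu y * f y) ->
  (forall y, y != 0 -> Q (q * y) = mu y * Q y) ->
  (exists2 y, y != 0 & Q y != 0) ->
  (forall z, z != 0 -> 1 <= nm z < (nm q)^-1 -> exists c : C, forall e : R, 0 < e ->
     \forall y \near z, nm (f y - c * Q y) <= e * nm (Q y)) ->
  exists c, forall y, y != 0 -> f y = c * Q y.
Proof.
move=> hf hQ mu0 fq Qq [y0 y00 Qy0] loc.
have {}loc z : z != 0 -> exists c : C, forall e : R, 0 < e ->
     \forall y \near z, nm (f y - c * Q y) <= e * nm (Q y).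
  have inv : forall w, w != 0 -> (exists c : C, forall e : R, 0 < e ->
     \forall y \near w, nm (f y - c * Q y) <= e * nm (Q y)) <-> (exists c : C, forall e : R, 0 < e ->
     \forall y \near q * w, nm (f y - c * Q y) <= e * nm (Q y)).
    move=> w w0; have nw0 : 0 < nm w by rewrite nm_gt0.
    split=> -[c cP]; exists c => e e0; have /near_nmP[d d0 dP] := cP e e0; apply/near_nmP.
      exists (Num.min (nm q * d) (nm q * nm w)); first by rewrite lt_min !mulr_gt0.
      move=> y; rewrite lt_min => /andP[yd yw].
      have [x yE] : exists x, y = q * x by exists (q^-1 * y); rewrite mulVKf.
      move: yd yw; rewrite yE -mulrBr nmM !ltr_pM2l // => xd xw.
      have x0 : x != 0.
        by apply: contraTneq xw => ->; rewrite sub0r nmN ltxx.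
      rewrite fq // Qq // mulrCA -mulrBr !nmM mulrCA ler_pM2l ?nm_gt0 ?mu0 //.
      exact: dP.
    exists (Num.min d (nm w)); first by rewrite lt_min d0.
    move=> y; rewrite lt_min => /andP[yd yw].
    have x0 : y != 0 by apply: contraTneq yw => ->; rewrite sub0r nmN ltxx.
    have := dP (q * y); rewrite -mulrBr nmM.
    rewrite fq // Qq // mulrCA -mulrBr !nmM mulrCA ler_pM2l ?nm_gt0 ?mu0 //; apply.
    by apply: le_lt_trans yd; rewrite ler_piMl ?nm_ge0 // ltW.
  move=> z0; have [n zn] := q_window z0.
  apply/(q_invariant inv n z0); apply: loc => //.
  by rewrite mulf_neq0 // expfz_neq0.
have Qn0 z : z != 0 -> ~ (\forall y \near z, Q y = 0).
  move=> z0 /(holo_identity hQ z0 y00) /nbhs_singleton/eqP.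
  by rewrite (negbTE Qy0).
pose K : set C := [set z | 1 <= nm z <= (nm q)^-1].
have K0 z : K z -> z != 0.
  by move=> /andP[z1 _]; rewrite -nm_gt0 (lt_le_trans _ z1).
have cK : compact K by exact: compact_annulus.
pose bounded B := forall y, y != 0 -> nm (f y) <= B * nm (Q y).
have boundedK B : (forall z, K z -> nm (f z) <= B * nm (Q z)) -> bounded B.
  move=> BK; pose P y := nm (f y) <= B * nm (Q y).
  have inv y : y != 0 -> P y <-> P (q * y).
    by move=> yn0; rewrite /P fq // Qq // !nmM mulrCA ler_pM2l ?nm_gt0 ?mu0.
  move=> y yn0; have [n /andP[n1 n2]] := q_window yn0.
  apply/(q_invariant inv n yn0); apply: BK; rewrite /K /= n1 ltW //.
have [B0 B0P] : exists B, bounded B.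
  have [N NP] : exists n : nat, forall z, K z -> nm (f z) <= n%:R * nm (Q z).
    apply: compact_uniform => //.
      move=> m n z mn /le_trans; apply; rewrite ler_wpM2r ?nm_ge0 // ler_nat //.
    move=> z /K0 /loc[c cP]; exists (Num.truncn (nm c + 1)).+1.
    apply: filterS (cP 1 ltr01) => y yc.
    apply: (@le_trans _ _ ((nm c + 1) * nm (Q y))).
      rewrite mulrDl -nmM; have := nmD (f y - c * Q y) (c * Q y); rewrite subrK; lra.
    by rewrite ler_wpM2r ?nm_ge0 // ltW // truncnS_gt.
  by exists N%:R; exact: boundedK.
have Qpos : 0 < nm (Q y0) by rewrite nm_gt0.
pose S := [set B | bounded B].
have S0 : has_inf S.
  split; first by exists B0.
  exists 0 => B BP; have := BP y0 y00; have := nm_ge0 (f y0) => h1 h2.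
  by rewrite -(pmulr_lge0 _ Qpos) (le_trans h1).
pose M := inf S.
have MS : bounded M.
  move=> y yn0; apply/ler_addgt0Pl => e e0.
  have [Qy|Qy] := eqVneq (Q y) 0.
    by have := B0P y yn0; rewrite Qy nm0 !mulr0 => h; rewrite (le_trans h) // addr0 ltW.
  have Qyp : 0 < nm (Q y) by rewrite nm_gt0.
  have [B SB BM] := inf_adherent (divr_gt0 e0 Qyp) S0.
  apply: le_trans (SB y yn0) _; rewrite -ler_pdivlMr // mulrDl mulfK ?gt_eqF //.
  by rewrite addrC ltW.
have Mmin B : bounded B -> M <= B by move=> BS; apply: ge_inf => //; case: S0.
have M0 : 0 <= M.
  by have := MS y0 y00; have := nm_ge0 (f y0) => h1 h2; rewrite -(pmulr_lge0 _ Qpos) (le_trans h1).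
move: M0; rewrite le_eqVlt => /orP[/eqP M00|Mpos].
  exists 0 => y yn0; apply/eqP; rewrite mul0r -nm_eq0 eq_le nm_ge0 andbT.
  by have := MS y yn0; rewrite -M00 mul0r.
have [[z [c [z0 fz]]]|none] := pselect (exists z c, z != 0 /\ \forall y \near z, f y = c * Q y).
  have hfQ : holo_off0 (fun y => f y - c * Q y).
    by move=> w w0; apply: holo_sub; [exact: hf|exact: holo_scale (hQ w w0)].
  exists c => y yn0; apply/eqP; rewrite -subr_eq0.
  have zero : \forall x \near z, f x - c * Q x = 0.
    by apply: filterS fz => x ->; rewrite subrr.
  by have /nbhs_singleton/eqP := holo_identity hfQ z0 yn0 zero.
exfalso.
have [n nP] : exists n : nat, forall z, K z -> nm (f z) <= (M - M / n.+2%:R) * nm (Q z).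
  apply: compact_uniform => //.
    move=> m n z mn /le_trans; apply; rewrite ler_wpM2r ?nm_ge0 //.
    by rewrite lerD2l lerN2 ler_pM2l // lef_pV2 ?posrE ?ltr0n // ler_nat !ltnS.
  move=> z Kz; have z0 := K0 z Kz; have [c cP] := loc z z0.
  have fM : \forall y \near z, nm (f y) <= M * nm (Q y).
    apply/near_nmP; exists (nm z); first by rewrite nm_gt0.
    by move=> y yz; apply: MS; apply: contraTneq yz => ->; rewrite sub0r nmN ltxx.
  have [fc|cM] := max_modulus (hf z z0) (hQ z z0) (Qn0 z z0) cP Mpos fM.
    by exfalso; apply: none; exists z, c.
  pose dl := (M - nm c) / 2.
  have dl0 : 0 < dl by rewrite divr_gt0 // subr_gt0.
  pose n := Num.truncn (M / dl); exists n.
  have nb : M / n.+2%:R <= dl.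
    rewrite ler_pdivrMr ?ltr0n // mulrC -ler_pdivrMr //.
    apply: ltW; apply: lt_trans (truncnS_gt _) _; by rewrite ltr_nat.
  apply: filterS (cP dl dl0) => y yc.
  apply: (@le_trans _ _ ((nm c + dl) * nm (Q y))).
    rewrite mulrDl -nmM; have := nmD (f y - c * Q y) (c * Q y); rewrite subrK; lra.
  rewrite ler_wpM2r ?nm_ge0 //; have dlE : dl * 2 = M - nm c by rewrite /dl; field.
  by move: (M / n.+2%:R) nb => x; lra.
have := Mmin _ (boundedK _ nP); rewrite leNgt => /negP; apply.
by rewrite gtrBl divr_gt0 ?ltr0n.
Unshelve. all: by end_near. Qed.

End Rigidity.

(** * Products of theta functions *)

Section Theta.
Variable R : realType.
Local Notation C := (Cplx R).
Local Notation nm := (@modulus R).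
Variable q : C.
Hypotheses (q0 : q != 0) (q1 : nm q < 1).
Local Notation theta := (theta q).
Implicit Types (f g : C -> C) (z w x y : C) (X : seq C).

Let nq0 : 0 < nm q. Proof. by rewrite nm_gt0. Qed.

Lemma theta_shift z : z != 0 -> theta (q * z) = - z^-1 * theta z.
Proof.
move=> z0; rewrite /theta.
have -> : q / (q * z) = z^-1 by rewrite invfM mulrA mulfV // mul1r.
rewrite (qpoch_infS q1 z) (qpoch_infS q1 z^-1) [z * q]mulrC [z^-1 * q]mulrC.
by field.
Qed.

Lemma theta_invol z : z != 0 -> theta (q / z) = theta z.
Proof.
move=> z0; rewrite /theta.
have -> : q / (q / z) = z by rewrite invf_div mulrCA mulfV // mulr1.
by rewrite [_ * qpoch_inf q z]mulrC.
Qed.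

Lemma theta_recip z : z != 0 -> theta z^-1 = - z^-1 * theta z.
Proof.
move=> z0; rewrite -theta_shift // -[RHS]theta_invol ?mulf_neq0 //.
by rewrite invfM mulrA mulfV // mul1r.
Qed.

Lemma theta1 : theta 1 = 0.
Proof. by rewrite /theta (qpoch_infS q1 1) subrr !mul0r. Qed.

Lemma qpoch_inf_small_neq0 z : nm z < 1 -> qpoch_inf q z != 0.
Proof.
move=> z1; apply: qpoch_inf_neq0 => // k; apply/eqP => /(congr1 nm).
rewrite nm1 nmM nmX => e; have : nm z * nm q ^+ k <= nm z.
  by rewrite ler_piMr ?nm_ge0 // exprn_ile1 ?nm_ge0 // ltW.
by rewrite e leNgt z1.
Qed.

Lemma theta_neq0 w : nm q < nm w < (nm q)^-1 -> w != 1 -> theta w != 0.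
Proof.
move=> /andP[qw wq] w1; have nw : 0 < nm w by exact: lt_trans qw.
rewrite /theta (qpoch_infS q1 w) !mulf_neq0 //.
- by rewrite subr_eq0 eq_sym.
- by apply: qpoch_inf_small_neq0; rewrite nmM -ltr_pdivlMr // mul1r.
- by apply: qpoch_inf_small_neq0; rewrite nmf_div ltr_pdivrMr // mul1r.
- exact: qpoch_inf_small_neq0.
Qed.

Lemma theta_nontrivial : exists2 t : C, t != 0 & theta t != 0.
Proof.
have iq : 1 < (nm q)^-1 by rewrite invf_gt1 // nm_gt0.
pose t : C := real_complex R ((1 + (nm q)^-1) / 2).
have nt : nm t = (1 + (nm q)^-1) / 2 by rewrite nm_pos //; lra.
exists t; first by rewrite -nm_gt0 nt; lra.
apply: theta_neq0 => //.
  by rewrite nt; move: iq q1; set i := _^-1; move: (nm q) i => b i ib b1; apply/andP; split; lra.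
by apply/eqP => /(congr1 nm); rewrite nt nm1; lra.
Qed.

Lemma holo_theta g z : holo g z -> holo (fun y => (g y)^-1) z ->
  holo (fun y => theta (g y)) z.
Proof.
move=> hg hi; apply: holo_mul; last exact: holo_cst.
apply: holo_mul; first exact: holo_qpoch_inf.
by apply: holo_qpoch_inf => //; exact: holo_scale.
Qed.

Lemma holo_theta_div x z : z != 0 -> holo (fun y => theta (y / x)) z.
Proof.
move=> z0; apply: holo_theta.
  by apply: holo_mul; [exact: holo_id|exact: holo_cst].
have := holo_scale x (holo_inv z0); congr holo.
by apply/funext => y; rewrite invfM invrK mulrC.
Qed.

Definition theta_prod X y : C := \prod_(x <- X) theta (y / x).

Lemma holo_theta_prod X : holo_off0 (theta_prod X).
Proof. by move=> z z0; apply: holo_prod => x; exact: holo_theta_div. Qed.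

Lemma theta_prod_shift X y : all (fun x => x != 0) X -> y != 0 ->
  theta_prod X (q * y) = \prod_(x <- X) (- x / y) * theta_prod X y.
Proof.
move=> X0 y0; rewrite /theta_prod -big_split /=.
rewrite big_seq [RHS]big_seq; apply: eq_bigr => x /(allP X0) /= x0.
have yx0 : y / x != 0 by rewrite mulf_neq0 // invr_eq0.
by rewrite -mulrA theta_shift // invf_div [- x / y]mulNr.
Qed.

(** A fundamental annulus for y -> q y: the quotient of two of its points lies
strictly between the circles of radii |q| and 1 / |q|, where 1 is the only
zero of theta. *)
Definition window x := (1 <= nm x) && (nm x < (nm q)^-1).

Lemma window_neq0 x : window x -> x != 0.
Proof. by move=> /andP[x1 _]; rewrite -nm_gt0; apply: lt_le_trans x1. Qed.

Lemma theta_window_neq0 x y : window x -> window y -> x != y -> theta (x / y) != 0.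
Proof.
move=> wx wy xy; have x0 := window_neq0 wx; have y0 := window_neq0 wy.
have ny0 : 0 < nm y by rewrite nm_gt0.
move/andP: wx => [x1 xq]; move/andP: wy => [y1 yq].
apply: theta_neq0; last by apply: contra_neq xy => /divr1_eq.
rewrite nmf_div ltr_pdivlMr // ltr_pdivrMr //; apply/andP; split.
  by apply: lt_le_trans x1; rewrite mulrC -ltr_pdivlMr // mul1r.
by apply: lt_le_trans xq _; rewrite ler_peMr // invr_ge0 ltW.
Qed.

Lemma theta_prod_neq0 X z : all window X -> window z -> z \notin X ->
  theta_prod X z != 0.
Proof.
move=> wX wz zX; rewrite /theta_prod big_seq prodf_seq_neq0; apply/allP => x xX.
apply/implyP => _; apply: theta_window_neq0 => //; first exact: (allP wX).
by apply: contraNneq zX => ->.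
Qed.

Lemma theta_prod_zero X z : z != 0 -> z \in X -> theta_prod X z = 0.
Proof.
move=> z0 zX; rewrite /theta_prod (big_rem z) //= mulfV // theta1 mul0r //.
Qed.

(** At a point z of the window at most one factor vanishes, and it contains
1 - y / z to the first power. *)
Lemma theta_prod_local X z : uniq X -> all window X -> window z ->
  exists P : C -> C, [/\ P @ z --> P z, P z != 0
    & forall y, y != 0 -> theta_prod X y = (y - z) ^+ (z \in X) * P y].
Proof.
move=> uX wX wz; have z0 := window_neq0 wz.
have [zX|zX] := boolP (z \in X); last first.
  exists (theta_prod X); split; last by move=> y _; rewrite expr0 mul1r.
    by apply: holo_cvg; exact: holo_theta_prod.
  exact: theta_prod_neq0.
pose T y := - z^-1 * (qpoch_inf q (y / z * q) * qpoch_inf q (q / (y / z)) * qpoch_inf q q)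
  * theta_prod (rem z X) y.
have hT : holo T z.
  apply: holo_mul; last exact: holo_theta_prod.
  apply: holo_scale; apply: holo_mul; last exact: holo_cst.
  apply: holo_mul; apply: holo_qpoch_inf => //.
    apply: holo_mul; last exact: holo_cst.
    by apply: holo_mul; [exact: holo_id|exact: holo_cst].
  apply: holo_scale; have := holo_scale z (holo_inv z0); congr holo.
  by apply/funext => y; rewrite invfM invrK mulrC.
exists T; split; first exact: holo_cvg hT.
  rewrite /T mulfV // mul1r invr1 mulr1 !mulf_neq0 ?oppr_eq0 ?invr_eq0 //;
    try exact: qpoch_inf_small_neq0.
  apply: theta_prod_neq0 => //; last by rewrite mem_rem_uniq // inE eqxx.
  by apply/allP => x /mem_rem; exact: (allP wX).
move=> y y0; rewrite expr1 /theta_prod (big_rem z) //= /T -/(theta_prod _ y).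
rewrite /theta (qpoch_infS q1 (y / z)) [in RHS]mulrA; congr (_ * _).
by field.
Qed.

(** The quotient f / Q has a limit as soon as a common factor can be removed. *)
Lemma ratio_near f Q z (u G P : C -> C) : G @ z --> G z -> P @ z --> P z -> P z != 0 ->
  (\forall y \near z, f y = u y * G y) -> (\forall y \near z, Q y = u y * P y) ->
  exists c : C, forall e : R, 0 < e ->
    \forall y \near z, nm (f y - c * Q y) <= e * nm (Q y).
Proof.
move=> Gc Pc Pz fG QP; pose c := G z / P z; exists c => e e0.
have cc : (fun y => G y / P y - c) @ z --> c - c.
  have h1 := at_inv Pz Pc; have h2 := at_mul Gc h1.
  exact: (at_sub h2 (@at_cst _ z c)).
have /cvg_atP/(_ e e0)[d d0 dP] := cc.
have Pn := near_neq0 Pc Pz.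
have nd : \forall y \near z, nm (y - z) < d by apply/near_nmP; exists d.
near=> y.
have Py : P y != 0 by near: y.
have fy : f y = u y * G y by near: y.
have Qy : Q y = u y * P y by near: y.
have yd : nm (y - z) < d by near: y.
have -> : f y - c * Q y = (G y / P y - c) * Q y by rewrite fy Qy; field.
rewrite nmM ler_wpM2r ?nm_ge0 // ltW //.
by have := dP y yd; rewrite subrr subr0.
Unshelve. all: by end_near. Qed.

(** The zeros of the product in the window are simple and shared by f, so the
quotient has a limit at each point of the window and [rigidity] applies. *)
Theorem theta_prod_rigidity X f : uniq X -> all window X -> holo_off0 f ->
  (forall y, y != 0 -> f (q * y) = \prod_(x <- X) (- x / y) * f y) ->
  (forall x, x \in X -> f x = 0) ->
  exists c, forall y, y != 0 -> f y = c * theta_prod X y.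
Proof.
move=> uX wX hf fq fX.
have X0 : all (fun x => x != 0) X by apply: sub_all wX => x; exact: window_neq0.
have near0 z : z != 0 -> \forall y \near z, y != 0.
  move=> z0; apply/near_nmP; exists (nm z); first by rewrite nm_gt0.
  by move=> y; apply: contraTneq => ->; rewrite sub0r nmN ltxx.
apply: (rigidity q0 q1 (mu := fun y => \prod_(x <- X) (- x / y))) => //.
- exact: holo_theta_prod.
- move=> y y0; rewrite prodf_seq_neq0; apply/allP => x xX /=.
  by rewrite mulf_neq0 ?oppr_eq0 ?invr_eq0 //; exact: (allP X0).
- by move=> y y0; exact: theta_prod_shift.
- have w1 : window 1 by rewrite /window nm1 lexx invf_gt1.
  have [P [Pc P1 QP]] := theta_prod_local uX wX w1.
  have /near_punctured[y y1 [y0 Py]] : \forall y \near (1 : C), y != 0 /\ P y != 0.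
    have h1 := near0 1 (oner_neq0 _); have h2 := near_neq0 Pc P1.
    by near=> y; split; near: y.
  by exists y; rewrite // QP // mulf_neq0 // expf_neq0 // subr_eq0.
- move=> z z0 wz.
  have [P [Pc Pz QP]] := theta_prod_local uX wX wz.
  have [G Gc fG] : exists2 G : C -> C, G @ z --> G z &
      \forall y \near z, f y = (y - z) ^+ (z \in X) * G y.
    have [zX|zX] := boolP (z \in X).
      have [G Gc fG] := holo_slope (hf z z0); exists G; first exact: Gc.
      by apply: filterS fG => y ->; rewrite fX // add0r expr1.
    exists f; first exact: holo_cvg (hf z z0).
    by apply/near_nmP; exists 1 => // y _; rewrite expr0 mul1r.
  apply: (ratio_near Gc Pc Pz fG).
  by apply: filterS (near0 z z0) => y; exact: QP.
Unshelve. all: by end_near. Qed.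

End Theta.

(** * Splitting of binary forms *)

Section Forms.
Variable R : realType.
Local Notation C := (Cplx R).
Local Notation nm := (@modulus R).

Lemma prodr_const_seq (I : Type) (s : seq I) (P : pred I) (c : C) :
  \prod_(i <- s | P i) c = c ^+ count P s.
Proof. by rewrite big_const_seq; elim: (count _ _) => [|n /= ->]; rewrite ?expr0 ?exprS. Qed.

Lemma count_neq m j : (j < m.+1)%N -> count (fun i => i != j) (index_iota 0 m.+1) = m.
Proof.
move=> jm; apply/eqP; rewrite -(eqn_add2l (count (pred1 j) (index_iota 0 m.+1))).
rewrite count_predC size_iota subn0 count_uniq_mem ?iota_uniq // mem_iota /= add0n.
by rewrite subn0 jm add1n.
Qed.

(** A sum of products of m linear forms in two variables is dehomogenized to a
polynomial of degree at most m; its roots give factors, and a drop of the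
degree gives factors w. *)
Lemma binary_form_factor m (lam al be : nat -> C) :
  exists (A : C) (ga de : nat -> C), forall x w : C,
    \sum_(0 <= j < m.+1) lam j * \prod_(0 <= i < m.+1 | i != j) (al i * x + be i * w)
    = A * \prod_(0 <= k < m) (ga k * x + de k * w).
Proof.
pose p : {poly C} := \sum_(0 <= j < m.+1)
  lam j *: \prod_(0 <= i < m.+1 | i != j) (al i *: 'X + (be i)%:P).
have sp : (size p <= m.+1)%N.
  apply: (leq_trans (size_sum _ _ _)); apply/bigmax_leqP_seq => j.
  rewrite mem_iota add0n subn0 => /andP[_ jm] _.
  apply: leq_trans (size_scale_leq _ _) _.
  rewrite -[X in (_ <= X.+1)%N](count_neq jm).
  elim: (index_iota 0 m.+1) => [|i s IH]; first by rewrite big_nil size_poly1.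
  rewrite big_cons /=; case: (i != j) => //=.
  apply: leq_trans (size_polyMleq _ _) _.
  have s2 : (size (al i *: 'X + (be i)%:P)%R <= 2)%N.
    apply: leq_trans (size_polyD _ _) _; rewrite geq_max.
    rewrite (leq_trans (size_scale_leq _ _)) ?size_polyX //.
    by rewrite (leq_trans (size_polyC_leq1 _)).
  move: s2 IH; set a := size _; set b := size _; set k := count _ _ => s2 IH; lia.
have [rs pE] : exists rs : seq C, p = lead_coef p *: \prod_(z <- rs) ('X - z%:P).
  by have [rs rsE] := closed_field_poly_normal (p : {poly R[i]}); exists rs.
pose n := size rs.
have nm_ : p != 0 -> (n <= m)%N.
  move=> p0; move: sp; rewrite pE size_scale ?lead_coef_eq0 //.
  by rewrite size_prod_XsubC.
exists (lead_coef p), (fun k => if (k < n)%N then 1 else 0),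
  (fun k => if (k < n)%N then - nth 0 rs k else 1) => x w.
pose lhs (w : C) := \sum_(0 <= j < m.+1) lam j * \prod_(0 <= i < m.+1 | i != j) (al i * x + be i * w).
pose rhs (w : C) := lead_coef p * \prod_(0 <= k < m)
  ((if (k < n)%N then 1 else 0) * x + (if (k < n)%N then - nth 0 rs k else 1) * w).
rewrite -/(lhs w) -/(rhs w).
(* both sides are homogeneous, so that they agree off w = 0 *)
have off0 v : v != 0 -> lhs v = rhs v.
  move=> v0.
  have -> : lhs v = v ^+ m * p.[x / v].
    rewrite /lhs /p horner_sum mulr_sumr; apply: eq_big_nat => j /andP[_ jm].
    rewrite hornerZ horner_prod mulrCA; congr (_ * _).
    have -> : v ^+ m = v ^+ count (fun i => i != j) (index_iota 0 m.+1).
      by rewrite count_neq.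
    rewrite -prodr_const_seq -big_split /=; apply: eq_bigr => i _.
    by rewrite hornerD hornerZ hornerX hornerC; field.
  have [p0|p0] := eqVneq p 0.
    by rewrite /rhs p0 horner0 mulr0 lead_coef0 mul0r.
  have nm1 := nm_ p0.
  rewrite /rhs [in LHS]pE hornerZ horner_prod mulrCA; congr (_ * _).
  rewrite (big_cat_nat (n := n)) //= [X in _ = _ * X](eq_big_nat _ _ (F2 := fun=> v)).
    rewrite prodr_const_nat.
    have -> : v ^+ m = \prod_(0 <= k < n) v * v ^+ (m - n).
      by rewrite prodr_const_nat subn0 -exprD subnKC.
    rewrite mulrAC; congr (_ * _); rewrite [X in _ * X = _](big_nth 0) -/n.
    rewrite -big_split /=; apply: eq_big_nat => k /andP[_ kn].
    by rewrite kn hornerXsubC; field.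
  by move=> k /andP[nk _]; rewrite ltnNge nk /= mul0r add0r mul1r.
have [->|w0] := eqVneq w 0; last exact: off0.
have lin (a b : C) : holo (fun v => a * x + b * v) 0.
  by apply: holo_add; [exact: holo_cst|exact: holo_scale (@holo_id _ _)].
have h : holo (fun v => lhs v - rhs v) 0.
  apply: holo_sub.
    by apply: holo_sum => j; apply: holo_scale; apply: holo_prod => i; exact: lin.
  by apply: holo_scale; apply: holo_prod => i; exact: lin.
case: (holo_isolated h) => [/nbhs_singleton/eqP|/near_punctured[v v0 /(_ v0)]].
  by rewrite subr_eq0 => /eqP.
by rewrite off0 // subrr eqxx.
Qed.
End Forms.

(** * Pairs of theta functions that are even under inversion *)

Section SymmetricThetaFunctions.
Variable R : realType.
Local Notation C := (Cplx R).
Local Notation nm := (@modulus R).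
Variable q : C.
Hypotheses (q0 : q != 0) (q1 : nm q < 1).
Local Notation theta := (theta q).
Local Notation win := (window q).
Local Notation Theta := (theta_prod q).
Implicit Types (f g : C -> C) (z w x y : C) (X : seq C).

Let nq0 : 0 < nm q. Proof. by rewrite nm_gt0. Qed.

(** Analytic functions on the punctured plane form an integral domain. *)
Lemma holo_mul_eq0 f g : holo_off0 f -> holo_off0 g ->
  (forall y, y != 0 -> f y * g y = 0) -> (exists2 y, y != 0 & f y != 0) ->
  forall y, y != 0 -> g y = 0.
Proof.
move=> hf hg fg [z z0 fz] y y0.
have fn : \forall x \near z, f x != 0.
  by apply: (near_neq0 _ fz); apply: holo_cvg; exact: hf.
have zn : \forall x \near z, x != 0 by apply: near_neq0 => //; exact: at_id.
have gz : \forall x \near z, g x = 0.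
  near=> x; have x0 : x != 0 by near: x.
  have fx : f x != 0 by near: x.
  by apply/eqP; have /eqP := fg x x0; rewrite mulf_eq0 (negbTE fx).
exact: nbhs_singleton (holo_identity hg z0 y0 gz).
Unshelve. all: by end_near. Qed.

Definition theta_pair rho y : C := theta (y / rho) * theta (q * rho * y).

Lemma theta_pairE rho y : rho != 0 ->
  theta_pair rho y = Theta [:: rho; (q * rho)^-1] y.
Proof.
by move=> r0; rewrite /theta_pair /theta_prod 2!big_cons big_nil mulr1 invrK [y * (q * rho)]mulrC.
Qed.

Lemma holo_theta_pair rho : rho != 0 -> holo_off0 (theta_pair rho).
Proof.
move=> r0; have -> : theta_pair rho = Theta [:: rho; (q * rho)^-1].
  by apply/funext => y; exact: theta_pairE.
exact: holo_theta_prod.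
Qed.

Lemma pair_multiplier rho y : rho != 0 -> y != 0 ->
  \prod_(x <- [:: rho; (q * rho)^-1]) (- x / y) = (q * y ^+ 2)^-1.
Proof.
by move=> r0 y0; rewrite 2!big_cons big_nil; field; rewrite r0 y0 q0.
Qed.

Lemma theta_pair_shift rho y : rho != 0 -> y != 0 ->
  theta_pair rho (q * y) = (q * y ^+ 2)^-1 * theta_pair rho y.
Proof.
move=> r0 y0; rewrite !theta_pairE // theta_prod_shift //; last first.
  by rewrite /= r0 invr_eq0 mulf_neq0.
by rewrite pair_multiplier.
Qed.

Lemma theta_pair_recip rho y : rho != 0 -> y != 0 -> theta_pair rho y^-1 = theta_pair rho y.
Proof.
move=> r0 y0; rewrite /theta_pair mulrC; congr (_ * _).
  rewrite -[RHS]theta_invol ?mulf_neq0 ?invr_eq0 //.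
  by rewrite invf_div mulrA.
rewrite -[RHS]theta_invol ?mulf_neq0 // -mulrA [RHS]/(theta _) invfM mulrA mulfV // mul1r invfM.
by rewrite mulrC.
Qed.

Lemma theta_pair_root rho : rho != 0 -> theta_pair rho rho = 0.
Proof. by move=> r0; rewrite /theta_pair mulfV // theta1 // mul0r. Qed.

Lemma theta_pair_nontrivial rho : rho != 0 -> exists2 y, y != 0 & theta_pair rho y != 0.
Proof.
move=> r0; apply: contrapT => none.
have zero y : y != 0 -> theta (y / rho) * theta (y / (q * rho)^-1) = 0.
  move=> y0; apply/eqP/negPn/negP => h; apply: none; exists y => //.
  by rewrite /theta_pair; move: h; rewrite invrK [y * (q * rho)]mulrC.
have [t t0 tht] := theta_nontrivial q0 q1.
have qr : q * rho != 0 by rewrite mulf_neq0.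
have h1 : holo_off0 (fun y => theta (y / rho)) by move=> y y0; exact: holo_theta_div.
have h2 : holo_off0 (fun y => theta (y / (q * rho)^-1)).
  by move=> y y0; exact: holo_theta_div.
have h3 : exists2 y, y != 0 & theta (y / rho) != 0.
  by exists (t * rho); [exact: mulf_neq0|rewrite mulfK].
have p0 : t / (q * rho) != 0 by rewrite mulf_neq0 // invr_eq0.
have := holo_mul_eq0 h1 h2 zero h3 p0.
by rewrite invrK mulfVK // => /eqP; rewrite (negbTE tht).
Qed.

(** The space of the functions sharing both functional equations with the pairs. *)
Definition even_pair_type f := [/\ holo_off0 f,
  forall y, y != 0 -> f (q * y) = (q * y ^+ 2)^-1 * f y
  & forall y, y != 0 -> f y^-1 = f y].

Lemma even_pair_lin f g (a b : C) : even_pair_type f -> even_pair_type g ->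
  even_pair_type (fun y => a * f y + b * g y).
Proof.
move=> [hf fq fi] [hg gq gi]; split.
- by move=> y y0; apply: holo_add; apply: holo_scale; [exact: hf|exact: hg].
- by move=> y y0; rewrite fq // gq //; ring.
- by move=> y y0; rewrite fi // gi.
Qed.

Lemma even_pair_theta rho : rho != 0 -> even_pair_type (theta_pair rho).
Proof.
move=> r0; split; first exact: holo_theta_pair.
- by move=> y; exact: theta_pair_shift.
- by move=> y; exact: theta_pair_recip.
Qed.

(** Strictly between the circles of radii 1 and |q|^(-1/2), so that [rho] and the
second zero [(q * rho)^-1] of its pair are separated by their moduli from each
other and from the zeros of the base products. *)
Definition inner rho := (1 < nm rho) && (nm rho ^+ 2 * nm q < 1).

Lemma inner_neq0 rho : inner rho -> rho != 0.
Proof. by move=> /andP[r1 _]; rewrite -nm_gt0; apply: lt_trans r1. Qed.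

Lemma inner_window rho : inner rho -> win rho && win (q * rho)^-1.
Proof.
move=> ir; have r0 := inner_neq0 ir; move: ir => /andP[r1 rq].
have nr0 : 0 < nm rho by rewrite nm_gt0.
have rq1 : nm q * nm rho < 1.
  apply: le_lt_trans rq; rewrite expr2 mulrC ler_pM2r // ler_peMr // ltW //.
rewrite /window nmV nmM (ltW r1) /=; apply/and3P; split.
- by rewrite -[ltRHS]mul1r ltr_pdivlMr // mulrC.
- by rewrite invf_ge1 ?mulr_gt0 // ltW.
- by rewrite ltf_pV2 ?posrE ?mulr_gt0 // ltr_pMr.
Qed.

Lemma nm_inner_dual rho : inner rho -> 1 < nm (q * rho)^-1 ^+ 2 * nm q.
Proof.
move=> ir; have r0 := inner_neq0 ir; move: ir => /andP[r1 rq].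
have nr0 : 0 < nm rho by rewrite nm_gt0.
rewrite nmV nmM exprVn mulrC ltr_pdivlMr ?exprn_gt0 ?mulr_gt0 // mul1r exprMn.
by rewrite expr2 -mulrA gtr_pMr // mulrC.
Qed.

Lemma inner_dual_neq rho sig : inner rho -> inner sig -> rho != (q * sig)^-1.
Proof.
move=> ir isg; apply/eqP => e; have := nm_inner_dual isg; rewrite -e.
by case/andP: ir => _ /ltW; rewrite leNgt => /negbTE ->.
Qed.

Lemma theta_pair_neq0 rho x : inner rho -> win x -> x != rho -> x != (q * rho)^-1 ->
  theta_pair rho x != 0.
Proof.
move=> ir wx x1 x2; rewrite theta_pairE; last exact: inner_neq0.
have /andP[w1 w2] := inner_window ir.
apply: theta_prod_neq0 => //; first by rewrite /= w1 w2.
by rewrite !inE negb_or x1 x2.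
Qed.

(** The zeros are stable under rho -> 1 / (q rho). *)
Lemma dual_root f x : x != 0 -> (forall y, y != 0 -> f y = 0 -> f (q * y) = 0) ->
  (forall y, y != 0 -> f y = 0 -> f y^-1 = 0) -> f x = 0 -> f (q * x)^-1 = 0.
Proof. by move=> x0 fq fi fx; apply: fi; [rewrite mulf_neq0|exact: fq]. Qed.

Lemma even_pair_root f rho : inner rho -> even_pair_type f -> f rho = 0 ->
  exists c, forall y, y != 0 -> f y = c * theta_pair rho y.
Proof.
move=> ir [hf fq fi] fr; have r0 := inner_neq0 ir.
have /andP[w1 w2] := inner_window ir.
have [|||||c cP] := theta_prod_rigidity q0 q1 (X := [:: rho; (q * rho)^-1]) (f := f).
- by rewrite /= inE inner_dual_neq.
- by rewrite /= w1 w2.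
- exact: hf.
- by move=> y y0; rewrite pair_multiplier // fq.
- move=> x; rewrite !inE => /orP[/eqP->//|/eqP->].
  apply: dual_root => // y y0 fy; first by rewrite fq // fy mulr0.
  by rewrite fi.
- by exists c => y y0; rewrite cP // theta_pairE.
Qed.

Section Span.
Variables (al be : C).
Hypotheses (ial : inner al) (ibe : inner be) (albe : nm al != nm be).

Let al0 := inner_neq0 ial.
Let be0 := inner_neq0 ibe.
Let ab : al != be. Proof. by apply: contra_neq albe => ->. Qed.

Let ua : theta_pair al be != 0.
Proof.
have /andP[w _] := inner_window ibe.
by apply: theta_pair_neq0; rewrite // 1?eq_sym // eq_sym inner_dual_neq.
Qed.

Let vb : theta_pair be al != 0.
Proof.
have /andP[w _] := inner_window ial.
by apply: theta_pair_neq0; rewrite // inner_dual_neq.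
Qed.

(** After subtraction of the combination that interpolates f at [al] and [be]
the difference is a multiple of the pair of [al] vanishing at [be]. *)
Lemma even_pair_span f : even_pair_type f -> exists a b, forall y, y != 0 ->
  f y = a * theta_pair al y + b * theta_pair be y.
Proof.
move=> tf; pose a := f be / theta_pair al be; pose b := f al / theta_pair be al.
pose g y := 1 * f y + (-1) * (a * theta_pair al y + b * theta_pair be y).
have tg : even_pair_type g.
  apply: even_pair_lin => //.
  by apply: even_pair_lin; exact: even_pair_theta.
have [|c gc] := even_pair_root ial tg.
  by rewrite /g theta_pair_root // /b; field.
have gb : g be = 0 by rewrite /g theta_pair_root // /a; field.
have c0 : c = 0.
  by apply/eqP; have /eqP := gc _ be0; rewrite gb eq_sym mulf_eq0 (negbTE ua) orbF.
exists a, b => y y0; apply/eqP; rewrite -subr_eq0.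
by have := gc y y0; rewrite c0 mul0r /g mul1r mulN1r => ->.
Qed.

(** Otherwise the pair of [al], having the same multiplier, would be a multiple
of f; but the pair has a zero and is not identically zero. *)
Lemma even_pair_has_root f : even_pair_type f -> exists2 rho, win rho & f rho = 0.
Proof.
move=> [hf fq fi]; apply: contrapT => none.
have inv y : y != 0 -> f y = 0 <-> f (q * y) = 0.
  move=> y0; rewrite fq //; split=> [->|/eqP]; first by rewrite mulr0.
  by rewrite mulf_eq0 invr_eq0 mulf_eq0 (negbTE q0) expf_eq0 (negbTE y0) => /eqP.
have fn0 y : y != 0 -> f y != 0.
  move=> y0; apply/eqP => fy; apply: none; have [n wn] := q_window q0 q1 y0.
  exists (q ^ n * y) => //.
  by apply/(q_invariant q0 inv n y0).
have [|||||||c cP] := rigidity q0 q1 (f := theta_pair al) (Q := f) (mu := fun y => (q * y ^+ 2)^-1).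
- exact: holo_theta_pair.
- exact: hf.
- by move=> y y0; rewrite invr_eq0 mulf_neq0 // expf_neq0.
- by move=> y; exact: theta_pair_shift.
- by move=> y; exact: fq.
- by exists 1; rewrite ?oner_neq0 // fn0 // oner_neq0.
- move=> z z0 _; apply: (@ratio_near _ _ _ _ (fun=> 1) (theta_pair al) f).
  + by apply: holo_cvg; exact: holo_theta_pair.
  + by apply: holo_cvg; exact: hf.
  + exact: fn0.
  + by apply/near_nmP; exists 1 => // y _; rewrite mul1r.
  + by apply/near_nmP; exists 1 => // y _; rewrite mul1r.
have c0 : c = 0.
  apply/eqP; have /eqP := cP al al0.
  by rewrite theta_pair_root // eq_sym mulf_eq0 (negbTE (fn0 _ al0)) orbF.
by move: ua; rewrite cP // c0 mul0r eqxx.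
Qed.

(** The left-hand side has a zero [rho], and so does the pair of [rho], which is
itself a combination of the two given pairs.  As these do not vanish together
at [rho], the two combinations are proportional. *)
Lemma even_pair_factor (ga de : C) : exists k rho : C, rho != 0 /\
  forall y, y != 0 -> ga * theta_pair al y + de * theta_pair be y = k * theta_pair rho y.
Proof.
have tg := even_pair_lin ga de (even_pair_theta al0) (even_pair_theta be0).
have [rho wr /= gr] := even_pair_has_root tg; have r0 := window_neq0 wr.
have [a [b ab_rho]] := even_pair_span (even_pair_theta r0).
have := ab_rho rho r0; rewrite theta_pair_root // => /esym hr.
set U := theta_pair al rho in gr hr; set V := theta_pair be rho in gr hr.
have UV : (U != 0) || (V != 0).
  rewrite -negb_and; apply/negP => /andP[/eqP U0 /eqP V0].
  have ra : (rho == al) || (rho == (q * al)^-1).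
    apply: contra_eqT U0; rewrite negb_or => /andP[h1 h2]; exact: theta_pair_neq0.
  have rb : (rho == be) || (rho == (q * be)^-1).
    apply: contra_eqT V0; rewrite negb_or => /andP[h1 h2]; exact: theta_pair_neq0.
  case/orP: ra => /eqP ra; case/orP: rb => /eqP rb.
  - by move: ab; rewrite -ra -rb eqxx.
  - by have := inner_dual_neq ial ibe; rewrite -ra -rb eqxx.
  - by have := inner_dual_neq ibe ial; rewrite -ra -rb eqxx.
  - have : (q * al)^-1 = (q * be)^-1 by rewrite -ra.
    by move=> /invr_inj/(mulfI q0) e; move: ab; rewrite e eqxx.
have det : a * de = b * ga.
  case/orP: UV => UV0; apply: (mulIf UV0).
    have e1 : ga * U = - (de * V) by apply/eqP; rewrite -addr_eq0 gr.
    have e2 : a * U = - (b * V) by apply/eqP; rewrite -addr_eq0 hr.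
    by rewrite mulrAC e2 -[b * ga * U]mulrA e1; ring.
  have e1 : de * V = - (ga * U) by apply/eqP; rewrite -addr_eq0 addrC gr.
  have e2 : b * V = - (a * U) by apply/eqP; rewrite -addr_eq0 addrC hr.
  by rewrite [RHS]mulrAC e2 -[a * de * V]mulrA e1; ring.
have ab0 : (a != 0) || (b != 0).
  rewrite -negb_and; apply/negP => /andP[/eqP a0 /eqP b0].
  have [y y0] := theta_pair_nontrivial r0.
  by rewrite ab_rho // a0 b0 !mul0r addr0 eqxx.
case/orP: ab0 => n0.
  exists (ga / a), rho; split=> // y y0; rewrite ab_rho //.
  have -> : de = b * ga / a by rewrite -det mulrAC mulfV // mul1r.
  by field.
exists (de / b), rho; split=> // y y0; rewrite ab_rho //.
have -> : ga = a * de / b by rewrite det mulrAC mulfV // mul1r.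
by field.
Qed.

End Span.
End SymmetricThetaFunctions.

(** * The product formula for solutions of the functional equations *)

Section ProductFormula.
Variable R : realType.
Local Notation C := (Cplx R).
Local Notation nm := (@modulus R).
Variable q : C.
Hypotheses (q0 : q != 0) (q1 : nm q < 1).
Local Notation Theta := (theta_prod q).
Local Notation pair_ := (theta_pair q).
Implicit Types (f g : C -> C) (z w x y : C) (X : seq C).

Let nq0 : 0 < nm q. Proof. by rewrite nm_gt0. Qed.

(** Interpolation points for every degree; distinct moduli keep the zeros of
different pairs apart. *)
Lemma inner_sequence : exists rho : nat -> C,
  (forall i, inner q (rho i)) /\ injective (fun i => nm (rho i)).
Proof.
have iq : 1 < (nm q)^-1 by rewrite invf_gt1.
pose T := Num.sqrt (nm q)^-1.
have T2 : T ^+ 2 = (nm q)^-1 by rewrite sqr_sqrtr // invr_ge0 ltW.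
have T0 : 0 <= T by exact: sqrtr_ge0.
have T1 : 1 < T by rewrite -(@ltr_pXn2r _ 2) ?nnegrE // expr1n T2.
pose r i : R := 1 + (T - 1) / i.+2%:R.
have T10 : 0 < T - 1 by rewrite subr_gt0.
have r1 i : 1 < r i by rewrite ltrDl divr_gt0.
have rT i : r i < T.
  by rewrite /r addrC -ltrBrDr ltr_pdivrMr // ltr_pMr // ltr1n.
have nr i : nm (real_complex R (r i)) = r i by rewrite nm_pos // ltW // (lt_trans _ (r1 i)).
exists (fun i => real_complex R (r i)); split.
  move=> i; rewrite /inner nr r1 /= -ltr_pdivlMr // mul1r -T2.
  by rewrite ltr_pXn2r ?nnegrE // ltW // (lt_trans _ (r1 i)).
move=> i j; rewrite !nr => /addrI/(mulfI (lt0r_neq0 T10))/invr_inj/eqP.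
by rewrite eqr_nat => /eqP [].
Qed.

Variable X0 : seq C.
Hypotheses (uX : uniq X0) (wX : all (window q) X0).
Hypothesis X0mod : all (fun x => (nm x == 1) || (nm x ^+ 2 * nm q == 1)) X0.
Hypothesis X0recip : forall y, y != 0 -> Theta X0 y^-1 = - y ^- 2 * Theta X0 y.

Let X0n : all (fun x => x != 0) X0.
Proof. by apply: sub_all wX => x; exact: window_neq0. Qed.

Lemma inner_notin x : inner q x -> x \notin X0 /\ (q * x)^-1 \notin X0.
Proof.
move=> ix; have [x1 x2] := andP ix; split; apply/negP => /(allP X0mod) /orP[/eqP e|/eqP e].
- by rewrite e ltxx in x1.
- by rewrite e ltxx in x2.
- have x0 := inner_neq0 ix; have := nm_inner_dual q0 ix.
  by rewrite e expr1n mul1r ltNge ltW.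
- by have := nm_inner_dual q0 ix; rewrite e ltxx.
Qed.

Definition theta_multiplier y : C := \prod_(x <- X0) (- x / y).

(** Interpolation at m + 1 inner points reduces f to the base product times a
form of degree m in pairs, which [binary_form_factor] and [even_pair_factor]
split into m pairs. *)
Theorem symmetric_theta_product m f : holo_off0 f ->
  (forall y, y != 0 -> f (q * y) = theta_multiplier y * (q * y ^+ 2) ^- m * f y) ->
  (forall y, y != 0 -> f y^-1 = - y ^- 2 * f y) ->
  (forall x, x \in X0 -> f x = 0) ->
  exists (A : C) (rho : nat -> C), (forall j, rho j != 0) /\
    forall y, y != 0 -> f y = A * Theta X0 y * \prod_(0 <= j < m) pair_ (rho j) y.
Proof.
move=> hf fq fi fX.
have [rho [ri rinj]] := inner_sequence.
have r0 i : rho i != 0 by exact: inner_neq0 (ri i).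
have rw i : window q (rho i) by have /andP[] := inner_window q0 (ri i).
pose L j y := Theta X0 y * \prod_(0 <= i < m.+1 | i != j) pair_ (rho i) y.
have pair_rho i k : i != k -> pair_ (rho i) (rho k) != 0.
  move=> ik; apply: theta_pair_neq0 => //.
    by apply: contra_neq ik => e; apply: rinj => /=; rewrite e.
  exact: inner_dual_neq.
have LK j : L j (rho j) != 0.
  rewrite mulf_neq0 //.
    by apply: theta_prod_neq0 => //; case: (inner_notin (ri j)).
  by rewrite prodf_seq_neq0; apply/allP => i _; apply/implyP; exact: pair_rho.
have L0 j k : (k < m.+1)%N -> k != j -> L j (rho k) = 0.
  move=> km kj; rewrite /L; apply/eqP; rewrite mulf_eq0; apply/orP; right; rewrite prodf_seq_eq0.
  apply/hasP; exists k; first by rewrite mem_iota add0n subn0.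
  by rewrite kj theta_pair_root // eqxx.
have hL j : holo_off0 (L j).
  move=> z z0; apply: holo_mul; first exact: holo_theta_prod.
  by apply: holo_prod => i; exact: holo_theta_pair.
have Lq j y : (j < m.+1)%N -> y != 0 -> L j (q * y) = theta_multiplier y * (q * y ^+ 2) ^- m * L j y.
  move=> jm y0; rewrite /L theta_prod_shift // -/(theta_multiplier y).
  under eq_bigr => i _ do rewrite theta_pair_shift //.
  rewrite big_split /= prodr_const_seq count_neq // exprVn.
  by rewrite !mulrA; congr (_ * _); rewrite mulrAC.
have Li j y : y != 0 -> L j y^-1 = - y ^- 2 * L j y.
  move=> y0; rewrite /L X0recip // -mulrA; congr (_ * (_ * _)).
  by apply: eq_bigr => i _; exact: theta_pair_recip.
pose lam j := f (rho j) / L j (rho j).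
pose g y := \sum_(0 <= j < m.+1) lam j * L j y.
pose D y := f y - g y.
(* g interpolates f at rho_0, ..., rho_m. *)
have Drho k : (k < m.+1)%N -> D (rho k) = 0.
  move=> km; rewrite /D /g (bigD1_seq k) ?iota_uniq ?mem_iota ?add0n ?subn0 //=.
  rewrite {1}/lam mulfVK // big1 ?addr0 ?subrr // => j jk.
  by rewrite L0 ?mulr0 // eq_sym.
have DX x : x \in X0 -> D x = 0.
  move=> xX; rewrite /D fX // sub0r /g big1 ?oppr0 // => j _.
  by rewrite /L theta_prod_zero ?(allP X0n) // mul0r mulr0.
have Dq y : y != 0 -> D (q * y) = theta_multiplier y * (q * y ^+ 2) ^- m * D y.
  move=> y0; rewrite /D fq // mulrBr; congr (_ - _); rewrite /g mulr_sumr.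
  by apply: eq_big_nat => j /andP[_ jm]; rewrite Lq // mulrCA.
have Di y : y != 0 -> D y^-1 = - y ^- 2 * D y.
  move=> y0; rewrite /D fi // mulrBr; congr (_ - _); rewrite /g mulr_sumr.
  by apply: eq_bigr => j _; rewrite Li // mulrCA.
have hD : holo_off0 D.
  move=> z z0; apply: holo_sub; first exact: hf.
  by apply: holo_sum => j; apply: holo_scale; exact: hL.
pose S := [seq rho i | i <- index_iota 1 m.+1].
pose S' := [seq (q * rho i)^-1 | i <- index_iota 1 m.+1].
have ThetaE y : Theta (X0 ++ S ++ S') y =
    Theta X0 y * \prod_(1 <= i < m.+1) pair_ (rho i) y.
  rewrite /theta_prod !big_cat /= !big_map -big_split /=; congr (_ * _).
  by apply: eq_bigr => i _; rewrite theta_pairE // /theta_prod 2!big_cons big_nil mulr1.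
have DC : exists c, forall y, y != 0 -> D y = c * Theta (X0 ++ S ++ S') y.
  apply: (theta_prod_rigidity q0 q1) => //.
  - have rI : injective rho by move=> i j e; apply: rinj; rewrite /= e.
    rewrite !cat_uniq uX /= !map_inj_uniq ?iota_uniq //=; last first.
      by move=> i j /invr_inj/(mulfI q0)/rI.
    rewrite andbT; apply/andP; split.
      apply/hasPn => x; rewrite mem_cat => /orP[] /mapP[i _ ->].
        by case: (inner_notin (ri i)).
      by case: (inner_notin (ri i)).
    apply/hasPn => x /mapP[i _ ->]; apply/mapP => -[j _ e].
    by have := inner_dual_neq q0 (ri j) (ri i); rewrite e eqxx.
  - rewrite !all_cat wX /=; apply/andP; split; apply/allP => x /mapP[i _ ->].
      exact: rw.
    by have /andP[] := inner_window q0 (ri i).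
  - move=> y y0; rewrite Dq // /theta_multiplier !big_cat /= !big_map; congr (_ * _ * _).
    rewrite -big_split /= -exprVn.
    have -> : (q * y ^+ 2)^-1 ^+ m = \prod_(1 <= i < m.+1) (q * y ^+ 2)^-1.
      by rewrite prodr_const_nat subSS subn0.
    by apply: eq_bigr => i _; rewrite -(pair_multiplier q0 (r0 i) y0) 2!big_cons big_nil mulr1.
  - have Sm i : i \in index_iota 1 m.+1 -> (i < m.+1)%N by rewrite mem_index_iota => /andP[].
    move=> x; rewrite !mem_cat => /or3P[|/mapP[i /Sm im ->]|/mapP[i /Sm im ->]].
    + exact: DX.
    + exact: Drho.
    + apply: (dual_root q0 (r0 i)); last exact: Drho.
        by move=> y y0 Dy; rewrite Dq // Dy mulr0.
      by move=> y y0 Dy; rewrite Di // Dy mulr0.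
have fg y : y != 0 -> f y = g y.
  have [c cP] := DC.
  have c0 : c = 0.
    apply/eqP; have := cP _ (r0 0%N); rewrite Drho // ThetaE => /esym/eqP.
    have n0 : Theta X0 (rho 0%N) * \prod_(1 <= i < m.+1) pair_ (rho i) (rho 0%N) != 0.
      rewrite mulf_neq0 //.
        by apply: theta_prod_neq0 => //; case: (inner_notin (ri 0%N)).
      rewrite prodf_seq_neq0; apply/allP => i; rewrite mem_index_iota => /andP[i0 _].
      by apply/implyP => _; apply: pair_rho; rewrite -lt0n.
    by rewrite mulf_eq0 (negbTE n0) orbF.
  by move=> y0; apply/eqP; rewrite -subr_eq0 -/(D y) cP // c0 mul0r.
(* In terms of two pairs, g becomes a binary form. *)
have r01 : nm (rho 0%N) != nm (rho 1%N) by apply/eqP => /rinj.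
have span i : exists ab : C * C, forall y, y != 0 ->
    pair_ (rho i) y = ab.1 * pair_ (rho 0%N) y + ab.2 * pair_ (rho 1%N) y.
  have [a [b abP]] := even_pair_span q0 q1 (ri 0%N) (ri 1%N) r01 (even_pair_theta q0 q1 (r0 i)).
  by exists (a, b).
have [ab abP] := choice span.
have [A [ga [de form]]] := binary_form_factor m lam (fun i => (ab i).1) (fun i => (ab i).2).
have fac k : exists kr : C * C, kr.2 != 0 /\ forall y, y != 0 ->
    ga k * pair_ (rho 0%N) y + de k * pair_ (rho 1%N) y = kr.1 * pair_ kr.2 y.
  have [c [r [rn0 rP]]] := even_pair_factor q0 q1 (ri 0%N) (ri 1%N) r01 (ga k) (de k).
  by exists (c, r).
have [kr krP] := choice fac.
exists (A * \prod_(0 <= k < m) (kr k).1), (fun k => (kr k).2); split.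
  by move=> k; case: (krP k).
move=> y y0; rewrite fg // /g.
have -> : \sum_(0 <= j < m.+1) lam j * L j y = Theta X0 y * \sum_(0 <= j < m.+1)
    lam j * \prod_(0 <= i < m.+1 | i != j) ((ab i).1 * pair_ (rho 0%N) y + (ab i).2 * pair_ (rho 1%N) y).
  rewrite mulr_sumr; apply: eq_bigr => j _; rewrite /L mulrCA; congr (_ * (_ * _)).
  by apply: eq_bigr => i _; exact: abP.
rewrite form.
under eq_bigr => k _ do rewrite (krP k).2 //.
by rewrite big_split /=; ring.
Qed.

(** Here the degree would be m = -1: multiplication by one pair leads to m = 0,
where f h is a multiple of the base product, which does not vanish at the zero
of the pair h. *)
Corollary symmetric_theta_vanish f : holo_off0 f ->
  (forall y, y != 0 -> f (q * y) = theta_multiplier y * (q * y ^+ 2) * f y) ->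
  (forall y, y != 0 -> f y^-1 = - y ^- 2 * f y) ->
  (forall x, x \in X0 -> f x = 0) ->
  forall y, y != 0 -> f y = 0.
Proof.
move=> hf fq fi fX; have [rho [ri _]] := inner_sequence.
have r0 : rho 0%N != 0 := inner_neq0 (ri 0%N).
pose g y := pair_ (rho 0%N) y * f y.
have [|||| A [sig [_ gA]]] := @symmetric_theta_product 0 g.
- by move=> z z0; apply: holo_mul; [exact: holo_theta_pair|exact: hf].
- move=> y y0; rewrite /g theta_pair_shift // fq //; field.
  by rewrite y0 q0.
- by move=> y y0; rewrite /g theta_pair_recip // fi // mulrCA.
- by move=> x xX; rewrite /g fX // mulr0.
have A0 : A = 0.
  have := gA _ r0; rewrite /g theta_pair_root // mul0r big_geq // mulr1.
  move/esym/eqP; rewrite mulf_eq0 => /orP[/eqP//|/eqP h].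
  have [nX _] := inner_notin (ri 0%N).
  have /andP[w _] := inner_window q0 (ri 0%N).
  by have := theta_prod_neq0 q0 q1 wX w nX; rewrite h eqxx.
apply: (holo_mul_eq0 (f := pair_ (rho 0%N))).
- exact: holo_theta_pair.
- exact: hf.
- by move=> y y0; have := gA y y0; rewrite /g A0 !mul0r.
- exact: theta_pair_nontrivial.
Qed.

End ProductFormula.

(** * Transformation of the bilateral series *)

Section BilateralSums.
Variable R : realType.
Local Notation C := (Cplx R).
Local Notation nm := (@modulus R).
Implicit Types (u : int -> C).

(** Convergence of both halves, which [bilateral_sum] by itself does not record. *)
Definition bisum u (S : C) := exists A B : C, [/\
  series (fun m : nat => u (Posz m)) @ \oo --> A,
  series (fun m : nat => u (Negz m)) @ \oo --> B & S = A + B].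

Lemma bisum_lim u S : bisum u S -> bilateral_sum u = S.
Proof.
move=> [A [B [uA uB ->]]]; rewrite /bilateral_sum.
by rewrite (cvg_lim _ uA) ?(cvg_lim _ uB) //; exact: norm_hausdorff.
Qed.

Lemma series_cvg_shift (v : nat -> C) A : series v @ \oo --> A ->
  series (fun m => v m.+1) @ \oo --> A - v 0%N.
Proof.
move=> vA; have -> : series (fun m => v m.+1) = (fun n => series v n.+1 - v 0%N).
  by apply/funext => n; rewrite /series /= big_nat_recl // addrAC subrr add0r.
by apply: cvgB; [rewrite cvg_shiftS|exact: cvg_cst].
Qed.

Lemma series_cvg_unshift (v : nat -> C) A c : series v @ \oo --> A ->
  series (fun m => if m is m'.+1 then v m' else c) @ \oo --> c + A.
Proof.
move=> vA; rewrite -cvg_shiftS.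
have -> : [sequence series (fun m => if m is m'.+1 then v m' else c) n.+1]_n
    = (fun n => c + series v n).
  by apply/funext => n; rewrite /series /= big_nat_recl.
by apply: cvgD; [exact: cvg_cst|exact: vA].
Qed.

Lemma bisum_shift u S : bisum u S -> bisum (fun n => u (n + 1)) S.
Proof.
move=> [A [B [uA uB ->]]]; exists (A - u 0), (u 0 + B); split; last by ring.
- have -> : (fun m : nat => u (m%:Z + 1)) = (fun m : nat => u (Posz m.+1)).
    by apply/funext => m; congr u; lia.
  exact: series_cvg_shift uA.
- have -> : (fun m : nat => u (Negz m + 1)) =
      (fun m : nat => if m is m'.+1 then u (Negz m') else u 0).
    by apply/funext => -[|m]; congr u; lia.
  exact: series_cvg_unshift uB.
Qed.

Lemma bisum_opp u S : bisum u S -> bisum (fun n => u (- n)) S.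
Proof.
move=> [A [B [uA uB ->]]]; exists (u 0 + B), (A - u 0); split; last by ring.
- have -> : (fun m : nat => u (- m%:Z)) =
      (fun m : nat => if m is m'.+1 then u (Negz m') else u 0).
    by apply/funext => -[|m]; congr u; lia.
  exact: series_cvg_unshift uB.
- have -> : (fun m : nat => u (- Negz m)) = (fun m : nat => u (Posz m.+1)).
    by apply/funext => m; congr u; lia.
  exact: series_cvg_shift uA.
Qed.

Lemma bisum_scale u S (c : C) : bisum u S -> bisum (fun n => c * u n) (c * S).
Proof.
have sc (v : nat -> C) (A : C) : series v @ \oo --> A ->
    series (fun m => c * v m) @ \oo --> c * A.
  move=> vA; have -> : series (fun m => c * v m) = (fun n => c * series v n).
    by apply/funext => n; rewrite /series /= mulr_sumr.
  by apply: cvgM; [exact: cvg_cst|exact: vA].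
move=> [A [B [uA uB ->]]]; exists (c * A), (c * B); split; last by rewrite mulrDr.
  exact: sc.
exact: sc.
Qed.

Lemma geometric_series_cvg (v : nat -> C) (K x : R) : 0 <= K -> 0 <= x -> x < 1 ->
  (forall n, nm (v n) <= K * x ^+ n) -> exists A : C, series v @ \oo --> A.
Proof.
move=> K0 x0 x1 vK.
have r0 := geom_tail_cvg0 K x0 x1.
apply: nm_cauchy_cvg => e e0.
move/cvgrPdist_lt: r0 => /(_ _ e0) [m _ /(_ m (leqnn m))].
rewrite sub0r normrN => /(le_lt_trans (ler_norm _)) me.
exists m => n mn; apply: le_lt_trans me.
have -> : series v n - series v m = \sum_(m <= k < n) v k.
  by rewrite /series /= (big_cat_nat (n := m)) //= addrAC subrr add0r.
apply: le_trans (nm_sum _ _ _) _; apply: le_trans (geom_sum_le K0 x0 x1 m n).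
by apply: ler_sum => k _.
Qed.

End BilateralSums.

Section FunctionalEquations.
Variable R : realType.
Local Notation C := (Cplx R).
Local Notation nm := (@modulus R).
Variables q s : C.
Hypotheses (q0 : q != 0) (q1 : nm q < 1) (sq : s ^+ 2 = q).
Implicit Types (f g : C -> C) (z w x y : C).

Let s0 : s != 0.
Proof. by apply: contra_neq q0 => e; rewrite -sq e expr0n. Qed.

(** The values for which no factor of any [qpoch q z n] vanishes. *)
Definition nonpower z := forall n : int, z * q ^ n != 1.

Lemma nonpowerM z (k : int) : nonpower z -> nonpower (z * q ^ k).
Proof. by move=> zP n; rewrite -mulrA -expfzDr. Qed.

Lemma nonpowerV z : nonpower z -> nonpower z^-1.
Proof.
move=> zP n; have := zP (- n); apply: contra_neq => /(congr1 GRing.inv).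
by rewrite invr1 invfM invrK invr_expz.
Qed.

Lemma nonpower_sub z (n : int) : nonpower z -> 1 - z * q ^ n != 0.
Proof. by move=> zP; rewrite subr_eq0 eq_sym. Qed.

Lemma qpochS_gen z n : nonpower z -> qpoch q z (n + 1) = (1 - z * q ^ n) * qpoch q z n.
Proof. by move=> zP; apply: qpochS => _; exact: nonpower_sub. Qed.

Lemma qpoch_neq0 z n : nonpower z -> qpoch q z n != 0.
Proof.
move=> zP; case: n => m; rewrite /qpoch ?invr_eq0; apply/prodf_neq0 => k _.
  exact: (nonpower_sub k%:Z zP).
exact: nonpower_sub.
Qed.

Lemma qpoch_shift z n : nonpower z -> qpoch q z (n + 1) = (1 - z) * qpoch q (z * q) n.
Proof.
move=> zP; have zqP : nonpower (z * q) by exact: (nonpowerM 1 zP).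
have qn (k : int) : q * q ^ k = q ^ (k + 1) by rewrite [k + 1]addrC expfzDr.
have step k : qpoch q z (k + 1) = (1 - z) * qpoch q (z * q) k <->
    qpoch q z (k + 1 + 1) = (1 - z) * qpoch q (z * q) (k + 1).
  rewrite (qpochS_gen (k + 1) zP) (qpochS_gen k zqP) -[z * q * _]mulrA qn mulrCA.
  by split=> [->//|/(mulfI (nonpower_sub (k + 1) zP))].
elim/int_ind: n => [|n IH|n IH].
- by rewrite qpoch0 qpochS_gen // qpoch0 expr0z !mulr1.
- by have := (step n).1 IH; rewrite -[n.+1]addn1 PoszD.
- apply/(step _).2; have -> : - n.+1%:Z + 1 = - n%:Z by lia.
  exact: IH.
Qed.

(** The reflection n -> - n for one parameter; the powers of q and a that it
produces combine with the argument of the series. *)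
Lemma qpoch_reflect (a y : C) (n : nat) : a != 0 -> y != 0 ->
  nonpower (a * y) -> nonpower (y / a) ->
  qpoch q (a * y) (- n%:Z) / qpoch q (q * y / a) (- n%:Z) =
  (q / a ^+ 2) ^+ n * (qpoch q (a * y^-1) n / qpoch q (q * y^-1 / a) n).
Proof.
move=> a0 y0 P1 P2.
have P3 : nonpower (q * y / a) by rewrite -mulrA mulrC; exact: (nonpowerM 1).
have P4 : nonpower (a * y^-1).
  by have := nonpowerV P2; rewrite invf_div.
have P5 : nonpower (q * y^-1 / a).
  have -> : q * y^-1 / a = (a * y)^-1 * q ^ 1.
    by rewrite expr1z invfM [RHS]mulrC mulrA mulrAC.
  exact: (nonpowerM 1 (nonpowerV P1)).
elim: n => [|n IH]; first by rewrite oppr0 !qpoch0 expr0 [RHS]mul1r.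
have e1 : qpoch q (a * y) (- n%:Z) =
    (1 - a * y * q ^ (- n.+1%:Z)) * qpoch q (a * y) (- n.+1%:Z).
  by rewrite -qpochS_gen //; congr qpoch; lia.
have e2 : qpoch q (q * y / a) (- n%:Z) =
    (1 - q * y / a * q ^ (- n.+1%:Z)) * qpoch q (q * y / a) (- n.+1%:Z).
  by rewrite -qpochS_gen //; congr qpoch; lia.
have e3 : qpoch q (a * y^-1) n.+1 = (1 - a * y^-1 * q ^+ n) * qpoch q (a * y^-1) n.
  by rewrite -addn1 PoszD qpochS_gen.
have e4 : qpoch q (q * y^-1 / a) n.+1 = (1 - q * y^-1 / a * q ^+ n) * qpoch q (q * y^-1 / a) n.
  by rewrite -addn1 PoszD qpochS_gen.
have n1 := nonpower_sub (- n.+1%:Z) P1; have n2 := nonpower_sub (- n.+1%:Z) P3.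
have n4 : 1 - q * y^-1 / a * q ^+ n != 0 by exact: (nonpower_sub n%:Z P5).
have -> : qpoch q (a * y) (- n.+1%:Z) / qpoch q (q * y / a) (- n.+1%:Z) =
    qpoch q (a * y) (- n%:Z) / qpoch q (q * y / a) (- n%:Z) *
    ((1 - q * y / a * q ^ (- n.+1%:Z)) / (1 - a * y * q ^ (- n.+1%:Z))).
  rewrite e1 e2; have := qpoch_neq0 (- n.+1%:Z) P3.
  move: n1 n2; move: (qpoch q (a * y) _) (qpoch q (q * y / a) _) => A B.
  move: (1 - a * y * _) (1 - q * y / a * _) => U V U0 V0 B0.
  by field; rewrite U0 V0 B0.
rewrite IH e3 e4 exprS.
have := qpoch_neq0 n P5; move: (qpoch q (a * y^-1) n) (qpoch q (q * y^-1 / a) n) => A B B0.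
move: n1 n2 n4; rewrite -exprnN !exprS.
have qn0 : q ^+ n != 0 by rewrite expf_neq0.
move: (q ^+ n) ((q / a ^+ 2) ^+ n) qn0 => Q X Q0 n1 n2 n4.
have D0 : q * Q - a * y != 0.
  apply: contra_neq n1 => /eqP; rewrite subr_eq0 => /eqP <-.
  by rewrite mulfV ?subrr // mulf_neq0.
have D1 : a * y - q * Q != 0 by rewrite -oppr_eq0 opprB.
by field; rewrite a0 y0 B0 [y * a]mulrC D1 Q0 q0 D0.
Qed.

Section Term.
Variables (r : nat) (a : 'I_(r - 2) -> C).
Hypotheses (r3 : (3 <= r)%N) (a0 : forall i, a i != 0).

(** A condition stronger than [not_pole], chosen to be stable under y -> q y and
y -> 1 / y, so that all terms of the series can be transformed freely. *)
Definition generic y := forall i, nonpower (a i * y) /\ nonpower (y / a i).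

Lemma genericM y : generic y -> generic (q * y).
Proof.
move=> gy i; have [P1 P2] := gy i; split.
  by rewrite mulrCA mulrC; exact: (nonpowerM 1).
by rewrite -mulrA mulrC; exact: (nonpowerM 1).
Qed.

Lemma genericV y : generic y -> generic y^-1.
Proof.
move=> gy i; have [P1 P2] := gy i; split.
  by rewrite -[a i / y]invf_div; exact: nonpowerV.
by rewrite -invfM mulrC; exact: nonpowerV.
Qed.

Lemma generic_not_pole y : generic y -> not_pole q a y.
Proof.
move=> gy i k; have [P1 P2] := gy i; split; last exact: P1.
have -> : q * y / a i * q ^+ k = y / a i * q ^ (k.+1%:Z).
  by rewrite -exprnP exprS; ring.
exact: P2.
Qed.

Local Notation Z := (Wratio s a).
Let aprod0 : \prod_i a i != 0.
Proof. by apply/prodf_neq0 => i _. Qed.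
Let Z0 : Z != 0.
Proof. by rewrite mulf_neq0 ?invr_eq0 // expfz_neq0. Qed.

Lemma Wterm_shift y n : generic y ->
  Wterm q s a y (n + 1) =
  Z * \prod_i ((1 - a i * y) / (1 - q * y / a i)) * Wterm q s a (q * y) n.
Proof.
move=> gy; rewrite /Wterm.
have -> : \prod_i qpoch q (a i * y) (n + 1) =
    \prod_i (1 - a i * y) * \prod_i qpoch q (a i * (q * y)) n.
  rewrite -big_split /=; apply: eq_bigr => i _; have [P1 P2] := gy i.
  by rewrite qpoch_shift // mulrAC mulrA.
have -> : \prod_i qpoch q (q * y / a i) (n + 1) =
    \prod_i (1 - q * y / a i) * \prod_i qpoch q (q * (q * y) / a i) n.
  rewrite -big_split /=; apply: eq_bigr => i _; have [P1 P2] := gy i.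
  rewrite qpoch_shift; first by congr (_ * qpoch _ _ _); ring.
  by rewrite -mulrA mulrC; exact: (nonpowerM 1).
have -> : y ^+ 2 * q ^ (2 * (n + 1)) = (q * y) ^+ 2 * q ^ (2 * n).
  have -> : 2 * (n + 1) = 2 * n + 2 :> int by lia.
  by rewrite expfzDr // exprMn -exprnP; ring.
rewrite expfzDr // expr1z big_split /= prodfV invfM; ring.
Qed.

(** The powers of q and of the parameters from [qpoch_reflect], together with
those from the factor 1 - y^2 q^(2n), amount to the square of the argument of
the series; this is where its very-well-poised form is used. *)
Lemma Wterm_reflect_nat y (n : nat) : y != 0 -> generic y ->
  Wterm q s a y (- n%:Z) = - y ^+ 2 * Wterm q s a y^-1 n%:Z.
Proof.
move=> y0 gy; rewrite /Wterm -!prodf_div.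
have -> : \prod_i (qpoch q (a i * y) (- n%:Z) / qpoch q (q * y / a i) (- n%:Z)) =
   (q ^+ (r - 2) / (\prod_i a i) ^+ 2) ^+ n *
   \prod_i (qpoch q (a i * y^-1) n / qpoch q (q * y^-1 / a i) n).
  have -> : (q ^+ (r - 2) / (\prod_i a i) ^+ 2) ^+ n = \prod_i ((q / a i ^+ 2) ^+ n).
    rewrite prodrXl; congr (_ ^+ n); rewrite prodf_div prodr_const card_ord.
    by rewrite prodrXl.
  rewrite -big_split /=; apply: eq_bigr => i _; have [P1 P2] := gy i.
  exact: qpoch_reflect.
set P := \prod_i (_ / _).
have Z2 : q ^+ (r - 2) / (\prod_i a i) ^+ 2 = q ^+ 2 * Z ^+ 2.
  rewrite /Wratio exprMn exprVn mulrA; congr (_ * _).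
  rewrite -sq !exprnP !exprz_exp -expfzDr //; congr (s ^ _); lia.
have -> : q ^ (2 * - n%:Z) = (q ^+ n ^+ 2)^-1.
  have -> : 2 * - n%:Z = - (n * 2)%N%:Z by lia.
  by rewrite -exprnN exprM.
have -> : q ^ (2 * n%:Z) = q ^+ n ^+ 2.
  by rewrite -exprM exprnP; congr (q ^ _); lia.
rewrite Z2 exprMn !(exprAC _ 2) -exprnN -exprnP exprVn.
have Qn0 : q ^+ n != 0 by rewrite expf_neq0.
have Zn0 : Z ^+ n != 0 by rewrite expf_neq0.
move: (q ^+ n) (Z ^+ n) Qn0 Zn0 => Q Zn Qn0 Zn0.
by field; rewrite y0 Qn0 Zn0.
Qed.

Lemma Wterm_reflect y n : y != 0 -> generic y ->
  Wterm q s a y (- n) = - y ^+ 2 * Wterm q s a y^-1 n.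
Proof.
move=> y0 gy; case: n => n; first exact: Wterm_reflect_nat.
rewrite NegzE opprK [in RHS]Wterm_reflect_nat ?invr_eq0 //; last exact: genericV.
by rewrite invrK exprVn; field.
Qed.

Hypothesis Zlt : nm Z < 1.

Lemma Wterm_bound y : generic y ->
  exists2 K : R, 0 <= K & forall n : nat, nm (Wterm q s a y n%:Z) <= K * nm Z ^+ n.
Proof.
move=> gy.
have lo i : exists e : R, 0 < e /\ forall m : nat, e <= nm (qpoch q (q * y / a i) m%:Z).
  have [|e e0 eP] := @qpoch_lower R q q1 (q * y / a i).
    by move=> k; have [] := generic_not_pole gy i k.
  by exists e.
have [e eP] := choice lo.
pose K1 : R := \prod_i expR (nm (a i * y) / (1 - nm q)).
pose K2 : R := \prod_i e i.
have K20 : 0 < K2 by apply: prodr_gt0 => i _; case: (eP i).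
have K10 : 0 <= K1 by apply: prodr_ge0 => i _; exact: expR_ge0.
exists (K1 / K2 * (1 + nm y ^+ 2)).
  by rewrite mulr_ge0 ?divr_ge0 ?addr_ge0 ?exprn_ge0 ?nm_ge0 // ltW.
move=> n; rewrite /Wterm nmM nmXz -exprnP ler_wpM2r ?exprn_ge0 ?nm_ge0 //.
rewrite nmM nmf_div; apply: ler_pM; rewrite ?divr_ge0 ?nm_ge0 //.
  apply: ler_pM; rewrite ?invr_ge0 ?nm_ge0 //.
    by rewrite nm_prod; apply: ler_prod => i _; rewrite nm_ge0 /=; exact: qpoch_le.
  have le2 : K2 <= nm (\prod_i qpoch q (q * y / a i) n).
    rewrite nm_prod; apply: ler_prod => i _; have [e0 eB] := eP i.
    by rewrite ltW //=; exact: eB.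
  by rewrite lef_pV2 ?posrE // (lt_le_trans K20).
apply: le_trans (nmB _ _) _; rewrite nm1 lerD2l nmM nmX.
have -> : 2 * n%:Z = (2 * n)%N%:Z by lia.
by rewrite -exprnP nmX ler_piMr ?exprn_ge0 ?nm_ge0 // exprn_ile1 ?nm_ge0 // ltW.
Qed.

(** The terms of index n >= 0 are bounded by a geometric series; those of index
n < 0 are, by reflection, terms of index > 0 at 1 / y. *)
Lemma Wterm_bisum y : y != 0 -> generic y -> exists S, bisum (Wterm q s a y) S.
Proof.
move=> y0 gy.
have pos x : generic x -> exists A : C, series (fun m : nat => Wterm q s a x m%:Z) @ \oo --> A.
  move=> gx; have [K K0 Kb] := Wterm_bound gx.
  exact: geometric_series_cvg K0 (nm_ge0 _) Zlt Kb.
have [A AP] := pos _ gy; have [B BP] := pos _ (genericV gy).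
exists (A + - y ^+ 2 * (B - Wterm q s a y^-1 0)), A, (- y ^+ 2 * (B - Wterm q s a y^-1 0)).
split; [exact: AP| |by []].
have -> : series (fun m : nat => Wterm q s a y (Negz m)) =
   (fun n => - y ^+ 2 * series (fun m : nat => Wterm q s a y^-1 m.+1%:Z) n).
  apply/funext => n; rewrite /series /= mulr_sumr; apply: eq_bigr => m _.
  by rewrite NegzE Wterm_reflect.
have B1 := series_cvg_shift BP.
by apply: cvgM; [exact: cvg_cst|exact: B1].
Qed.

Lemma Wseries_shift y : y != 0 -> generic y -> Wseries q s a y =
  Z * \prod_i ((1 - a i * y) / (1 - q * y / a i)) * Wseries q s a (q * y).
Proof.
move=> y0 gy; have qy0 : q * y != 0 by rewrite mulf_neq0.
have [S SP] := Wterm_bisum y0 gy; have [T TP] := Wterm_bisum qy0 (genericM gy).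
rewrite /Wseries (bisum_lim SP) (bisum_lim TP).
rewrite -(bisum_lim (bisum_shift SP)) -(bisum_lim (bisum_scale _ TP)).
by congr bilateral_sum; apply/funext => n; exact: Wterm_shift.
Qed.

Lemma Wseries_reflect y : y != 0 -> generic y ->
  Wseries q s a y = - y ^+ 2 * Wseries q s a y^-1.
Proof.
move=> y0 gy; have iy0 : y^-1 != 0 by rewrite invr_eq0.
have [S SP] := Wterm_bisum y0 gy; have [T TP] := Wterm_bisum iy0 (genericV gy).
rewrite /Wseries (bisum_lim SP) (bisum_lim TP).
rewrite -(bisum_lim (bisum_opp SP)) -(bisum_lim (bisum_scale _ TP)).
by congr bilateral_sum; apply/funext => n; exact: Wterm_reflect.
Qed.

Lemma Wden_neq0 y : generic y -> Wden q s a y != 0.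
Proof.
move=> gy; rewrite mulf_neq0 //.
  exact: qpoch_inf_small_neq0.
apply/prodf_neq0 => i _; have [P1 P2] := gy i; rewrite mulf_neq0 //.
  apply: qpoch_inf_neq0 => // k.
  have -> : q / (a i * y) * q ^+ k = (a i * y)^-1 * q ^ (k.+1%:Z).
    by rewrite -exprnP exprS; ring.
  exact: (nonpowerV P1).
apply: qpoch_inf_neq0 => // k; exact: (generic_not_pole gy i k).1.
Qed.

Lemma Wden_recip y : Wden q s a y^-1 = Wden q s a y.
Proof.
rewrite /Wden; congr (_ * _); apply: eq_bigr => i _; rewrite mulrC.
by congr (_ * _); congr qpoch_inf; rewrite invfM ?invrK; ring.
Qed.

(** The factors 1 - q y / a_i cancel those produced by [Wseries_shift], and
(1 - a_i y) / (1 - 1 / (a_i y)) = - a_i y is a monomial. *)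
Lemma Wden_shift y : y != 0 ->
  Wden q s a (q * y) * \prod_i (1 - q * y / a i) =
  \prod_i (1 - (a i * y)^-1) * Wden q s a y.
Proof.
move=> y0; rewrite /Wden -mulrA [RHS]mulrCA; congr (_ * _); rewrite -!big_split /=.
apply: eq_bigr => i _.
have -> : q / (a i * (q * y)) = (a i * y)^-1 by field; rewrite q0 y0 a0.
rewrite (qpoch_infS q1 (a i * y)^-1) (qpoch_infS q1 (q * y / a i)).
have -> : (a i * y)^-1 * q = q / (a i * y) by rewrite mulrC.
have -> : q * y / a i * q = q * (q * y) / a i by ring.
ring.
Qed.

End Term.
End FunctionalEquations.

(** * Functional equations of the numerator by continuation *)

Section Continuation.
Variable R : realType.
Local Notation C := (Cplx R).
Local Notation nm := (@modulus R).
Implicit Types (f g : C -> C) (z w x y : C).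

Lemma at_comp f g z : g @ z --> g z -> f @ (g z) --> f (g z) ->
  (fun y => f (g y)) @ z --> f (g z).
Proof.
move=> /cvg_atP gc /cvg_atP fc; apply/cvg_atP => e /fc[d d0 dP].
by have [d' d'0 d'P] := gc d d0; exists d' => // w /d'P/dP.
Qed.

Lemma continuous_zero_at f z : f @ z --> f z ->
  (\forall y \near z, y != z -> f y = 0) -> f z = 0.
Proof.
move=> fc fz; have [//|fn] := eqVneq (f z) 0.
have fy := near_neq0 fc fn.
have /near_punctured[y yz [h1 h2]] : \forall y \near z, (y != z -> f y = 0) /\ f y != 0.
  by near=> y; split; near: y.
by move: h2; rewrite h1 // eqxx.
Unshelve. all: by end_near. Qed.

Variables q s : C.
Hypotheses (q0 : q != 0) (q1 : nm q < 1) (sq : s ^+ 2 = q).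

Let s0 : s != 0.
Proof. by apply: contra_neq q0 => e; rewrite -sq e expr0n. Qed.

Lemma theta_neq0_nonpower w : theta q w != 0 -> nonpower q w.
Proof.
move=> tw n; apply: contra_neq tw => wn.
have w0 : w != 0 by apply: contra_eq_neq wn => ->; rewrite mul0r eq_sym oner_neq0.
have inv z : z != 0 -> theta q z = 0 <-> theta q (q * z) = 0.
  move=> z0; rewrite theta_shift //; split=> [->|/eqP]; first by rewrite mulr0.
  by rewrite mulf_eq0 oppr_eq0 invr_eq0 (negbTE z0) => /eqP.
by apply/(q_invariant q0 inv n w0); rewrite mulrC wn theta1.
Qed.

Lemma near_theta_neq0 x z : x != 0 -> z != 0 ->
  \forall y \near z, y != z -> theta q (y / x) != 0.
Proof.
move=> x0 z0; have ho : holo_off0 (fun y => theta q (y / x)).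
  by move=> w w0; exact: holo_theta_div.
case: (holo_isolated (ho z z0)) => [zz|nz]; last exact: nz.
have [t t0 tt] := theta_nontrivial q0 q1.
have tx0 : t * x != 0 by rewrite mulf_neq0.
have := holo_identity ho z0 tx0 zz => /nbhs_singleton/eqP.
by rewrite mulfK // (negbTE tt).
Qed.

(** Every excluded value of y is a zero of one of finitely many theta functions,
and these zeros are isolated. *)
Lemma near_generic r (a : 'I_(r - 2) -> C) z : (forall i, a i != 0) -> z != 0 ->
  \forall y \near z, y != z -> generic q a y.
Proof.
move=> a0 z0.
have loc i : \forall y \near z, y != z -> nonpower q (a i * y) /\ nonpower q (y / a i).
  have h1 : \forall y \near z, y != z -> theta q (y / (a i)^-1) != 0.
    by apply: near_theta_neq0; rewrite // invr_eq0.
  have h2 := near_theta_neq0 (a0 i) z0.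
  near=> y => yz; split; apply: theta_neq0_nonpower.
    by rewrite mulrC -[a i]invrK; move: yz; near: y.
  by move: yz; near: y.
have [d dP] : exists d : 'I_(r - 2) -> R, forall i, 0 < d i /\
    forall y, nm (y - z) < d i -> y != z -> nonpower q (a i * y) /\ nonpower q (y / a i).
  suff h i : exists e : R, 0 < e /\
      forall y, nm (y - z) < e -> y != z -> nonpower q (a i * y) /\ nonpower q (y / a i).
    by have [d dP] := choice h; exists d.
  by have /near_nmP[e e0 eP] := loc i; exists e.
apply/near_nmP; exists (\big[Num.min/1]_i d i).
  by apply: lt_bigmin => // i _; case: (dP i).
move=> y yd yz i; apply: (dP i).2 => //; apply: lt_le_trans yd _.
exact: bigmin_le_cond.
Unshelve. all: by end_near. Qed.

Variable r : nat.
Hypothesis r3 : (3 <= r)%N.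
Variable W : ('I_(r - 2) -> C) -> C -> C.
Hypothesis hW : is_Wstar q s r W.

Let multiplier y : C := s ^ (r%:Z - 4%:Z) * (- y) ^+ (r - 2).

Section ConvergenceRegion.
Variable a : 'I_(r - 2) -> C.
Hypotheses (a0 : forall i, a i != 0) (ca : nm (s ^ (r%:Z - 4%:Z)) < nm (\prod_i a i)).

Let Zlt : nm (Wratio s a) < 1.
Proof.
by rewrite /Wratio nmf_div ltr_pdivrMr ?mul1r // (le_lt_trans (nm_ge0 _) ca).
Qed.

Let WE y : y != 0 -> generic q a y -> W a y = Wseries q s a y * Wden q s a y.
Proof.
move=> y0 gy; have [_ _ h] := hW.
rewrite h ?lt_nm //; last exact: generic_not_pole.
by rewrite mulfVK //; exact: Wden_neq0.
Qed.

Lemma Wstar_generic_shift y : y != 0 -> generic q a y ->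
  W a y = multiplier y * W a (q * y).
Proof.
move=> y0 gy; have qy0 : q * y != 0 by rewrite mulf_neq0.
rewrite WE // WE //; last exact: genericM.
rewrite (Wseries_shift q0 q1 sq r3 a0 Zlt y0 gy) big_split /= prodfV.
have F0 : \prod_i (1 - q * y / a i) != 0.
  apply/prodf_neq0 => i _; rewrite subr_eq0 eq_sym.
  by have [/= + _] := generic_not_pole gy i 0; rewrite expr0 mulr1.
have ap0 : \prod_i a i != 0 by apply/prodf_neq0.
have eA : \prod_i (1 - a i * y) = (- y) ^+ (r - 2) * \prod_i a i * \prod_i (1 - (a i * y)^-1).
  rewrite -[in (- y) ^+ _](card_ord (r - 2)) -prodr_const -!big_split /=.
  by apply: eq_bigr => i _; field; rewrite y0 a0.
have eD := Wden_shift s q0 q1 a0 y0.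
rewrite /multiplier eA /Wratio; move: ap0 F0 eD.
set F := \prod_i (1 - q * y / a i); set E := \prod_i (1 - (a i * y)^-1).
move: (\prod_i a i) F E (Wden q s a (q * y)) (Wden q s a y) => P F E D1 D2 P0 F0 eD.
have -> : D1 = E * D2 / F by rewrite -eD mulfK.
by field; rewrite P0 F0.
Qed.

Lemma Wstar_generic_recip y : y != 0 -> generic q a y ->
  W a y = - y ^+ 2 * W a y^-1.
Proof.
move=> y0 gy; have iy0 : y^-1 != 0 by rewrite invr_eq0.
rewrite WE // WE //; last exact: genericV.
by rewrite (Wseries_reflect q0 q1 sq r3 a0 Zlt y0 gy) Wden_recip -[LHS]mulrA.
Qed.

End ConvergenceRegion.

Let holoW a : (forall i, a i != 0) -> holo_off0 (W a).
Proof. by move=> a0 z z0; have [h _ _] := hW; apply: analytic_holo; exact: h. Qed.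

Lemma Wstar_region_shift a y : (forall i, a i != 0) ->
  nm (s ^ (r%:Z - 4%:Z)) < nm (\prod_i a i) -> y != 0 ->
  W a y - multiplier y * W a (q * y) = 0.
Proof.
move=> a0 ca y0; have qy0 : q * y != 0 by rewrite mulf_neq0.
apply: (@continuous_zero_at (fun y => W a y - multiplier y * W a (q * y))).
  apply: at_sub; first exact: holo_cvg (holoW a0 y0).
  apply: at_mul.
    apply: holo_cvg; apply: holo_scale; apply: holo_exp; apply: holo_opp.
    exact: holo_id.
  apply: (@at_comp (W a) (fun y => q * y)); last exact: holo_cvg (holoW a0 qy0).
  by apply: at_mul; [exact: at_cst|exact: at_id].
have yn : \forall x \near y, x != 0 by apply: near_neq0 => //; exact: at_id.
have gn := near_generic a0 y0.
near=> x => xy; apply/eqP; rewrite subr_eq0; apply/eqP; apply: Wstar_generic_shift => //.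
  by near: x.
by move: xy; near: x.
Unshelve. all: by end_near. Qed.


Lemma Wstar_region_recip a y : (forall i, a i != 0) ->
  nm (s ^ (r%:Z - 4%:Z)) < nm (\prod_i a i) -> y != 0 ->
  W a y - (- y ^+ 2) * W a y^-1 = 0.
Proof.
move=> a0 ca y0; have iy0 : y^-1 != 0 by rewrite invr_eq0.
apply: (@continuous_zero_at (fun y => W a y - (- y ^+ 2) * W a y^-1)).
  apply: at_sub; first exact: holo_cvg (holoW a0 y0).
  apply: at_mul.
    apply: holo_cvg; apply: holo_opp; apply: holo_exp; exact: holo_id.
  apply: (@at_comp (W a) (fun y => y^-1)); last exact: holo_cvg (holoW a0 iy0).
  by apply: holo_cvg; exact: holo_inv.
have yn : \forall x \near y, x != 0 by apply: near_neq0 => //; exact: at_id.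
have gn := near_generic a0 y0.
near=> x => xy; apply/eqP; rewrite subr_eq0; apply/eqP; apply: Wstar_generic_recip => //.
  by near: x.
by move: xy; near: x.
Unshelve. all: by end_near. Qed.

(** Enlarging one parameter alone makes the series converge, and the relation is
analytic in that parameter, so it propagates along the punctured plane. *)
Lemma Wstar_continuation y1 y2 (c : C) : y1 != 0 -> y2 != 0 ->
  (forall a, (forall i, a i != 0) -> nm (s ^ (r%:Z - 4%:Z)) < nm (\prod_i a i) ->
     W a y1 - c * W a y2 = 0) ->
  forall a, (forall i, a i != 0) -> W a y1 = c * W a y2.
Proof.
move=> y10 y20 region a a0.
have i0 : 'I_(r - 2) by apply: (@Ordinal _ 0); rewrite subn_gt0.
pose b t : 'I_(r - 2) -> C := [eta a with i0 |-> t].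
have ba : b (a i0) = a by apply/funext => j; rewrite /b /=; case: eqP => [->|].
have b0 t : t != 0 -> forall i, b t i != 0.
  by move=> t0 i; rewrite /b /=; case: ifP => _; [exact: t0|exact: a0].
have hb : holo_off0 (fun t => W (b t) y1 - c * W (b t) y2).
  have [_ h _] := hW; move=> t t0; apply: holo_sub.
    by apply: analytic_holo; exact: (h a i0 y1 a0 y10 t t0).
  by apply: holo_scale; apply: analytic_holo; exact: (h a i0 y2 a0 y20 t t0).
pose P := \prod_(i | i != i0) a i.
have bP t : \prod_i b t i = t * P.
  rewrite (bigD1 i0) //= /b /= eqxx; congr (_ * _).
  by apply: eq_bigr => i /negbTE ->.
have nP : 0 < nm P by rewrite nm_gt0; apply/prodf_neq0.
pose B := nm (s ^ (r%:Z - 4%:Z)) / nm P.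
have B0 : 0 <= B by rewrite divr_ge0 ?nm_ge0.
pose t1 : C := real_complex R (B + 2).
have nt1 : nm t1 = B + 2 by rewrite nm_pos // addr_ge0.
have t10 : t1 != 0 by rewrite -nm_gt0 nt1; lra.
have zero : \forall t \near t1, W (b t) y1 - c * W (b t) y2 = 0.
  apply/near_nmP; exists 1 => // t tt.
  have tB : B < nm t by have := nm_lower t1 (t1 - t); rewrite opprB addrCA subrr addr0 nmBC in tt *; lra.
  have t0 : t != 0 by rewrite -nm_gt0 (le_lt_trans B0).
  by apply: region; [exact: b0|rewrite bP nmM -ltr_pdivrMr].
have /nbhs_singleton/eqP := holo_identity hb t10 (a0 i0) zero.
by rewrite ba subr_eq0 => /eqP.
Qed.

Theorem Wstar_shift a y : (forall i, a i != 0) -> y != 0 ->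
  W a y = s ^ (r%:Z - 4%:Z) * (- y) ^+ (r - 2) * W a (q * y).
Proof.
move=> a0 y0; apply: Wstar_continuation => //; first by rewrite mulf_neq0.
by move=> b b0 cb; exact: Wstar_region_shift.
Qed.

Theorem Wstar_recip a y : (forall i, a i != 0) -> y != 0 ->
  W a y = - y ^+ 2 * W a y^-1.
Proof.
move=> a0 y0; apply: Wstar_continuation => //; first by rewrite invr_eq0.
by move=> b b0 cb; exact: Wstar_region_recip.
Qed.

End Continuation.

(** * The base products of the odd and the even case *)

Section BaseProducts.
Variable R : realType.
Local Notation C := (Cplx R).
Local Notation nm := (@modulus R).
Variables q s : C.
Hypotheses (q0 : q != 0) (q1 : nm q < 1) (sq : s ^+ 2 = q).
Implicit Types (x y : C).

Let s0 : s != 0.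
Proof. by apply: contra_neq q0 => e; rewrite -sq e expr0n. Qed.
Let ns : nm s ^+ 2 = nm q. Proof. by rewrite -nmX sq. Qed.
Let ns0 : 0 < nm s. Proof. by rewrite nm_gt0. Qed.
Let ns1 : nm s < 1.
Proof. by rewrite -(@ltr_pXn2r _ 2) ?nnegrE ?nm_ge0 // expr1n ns. Qed.
Let opp1 : 1 != - 1 :> C.
Proof. by rewrite -subr_eq0 opprK -[1 + 1]/(2%:R) pnatr_eq0. Qed.

Lemma window1 : window q 1.
Proof. by rewrite /window nm1 lexx invf_gt1 // nm_gt0. Qed.

Lemma windowN x : window q (- x) = window q x.
Proof. by rewrite /window nmN. Qed.

Lemma window_sV : window q s^-1.
Proof.
rewrite /window nmV invf_ge1 // (ltW ns1) /= ltf_pV2 ?posrE ?nm_gt0 //.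
by rewrite -ns expr2 gtr_pMr.
Qed.

Lemma sV_neq x : nm x = 1 -> x != s^-1.
Proof.
move=> x1; apply/eqP => /(congr1 nm); rewrite x1 nmV => /esym/eqP.
by rewrite invr_eq1 => /eqP e; move: ns1; rewrite e ltxx.
Qed.

Definition odd_zeros : seq C := [:: 1; - 1; - s^-1].
Definition even_zeros : seq C := [:: 1; - 1; s^-1; - s^-1].

Lemma odd_zeros_uniq : uniq odd_zeros.
Proof.
rewrite /= !inE negb_or opp1 eqr_opp sV_neq ?nm1 // andbT /=.
by rewrite -[1]opprK eqr_opp sV_neq // nmN nm1.
Qed.

Lemma even_zeros_uniq : uniq even_zeros.
Proof.
rewrite /= !inE !negb_or opp1 eqr_opp !sV_neq ?nmN ?nm1 //= !andbT.
rewrite -[1 in X in X && _]opprK eqr_opp sV_neq ?nmN ?nm1 //=.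
by rewrite -subr_eq0 opprK -mulr2n mulrn_eq0 /= invr_eq0.
Qed.

Lemma odd_zeros_window : all (window q) odd_zeros.
Proof. by rewrite /= !windowN window1 window_sV. Qed.

Lemma even_zeros_window : all (window q) even_zeros.
Proof. by rewrite /= !windowN window1 window_sV. Qed.

Let sVmod : nm s^-1 ^+ 2 * nm q = 1.
Proof. by rewrite nmV exprVn ns mulVf // gt_eqF // nm_gt0. Qed.

Lemma odd_zeros_mod : all (fun x => (nm x == 1) || (nm x ^+ 2 * nm q == 1)) odd_zeros.
Proof. by rewrite /= !nmN nm1 sVmod !eqxx /= orbT. Qed.

Lemma even_zeros_mod : all (fun x => (nm x == 1) || (nm x ^+ 2 * nm q == 1)) even_zeros.
Proof. by rewrite /= !nmN nm1 sVmod !eqxx /= !orbT. Qed.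

Lemma odd_ThetaE y : theta_prod q odd_zeros y = theta q y * theta q (- y) * theta q (- y * s).
Proof.
rewrite /theta_prod 3!big_cons big_nil mulr1 divr1 mulrA invrN1 mulrN1.
by rewrite invrN invrK mulrN mulNr.
Qed.

Lemma even_ThetaE y : theta_prod q even_zeros y =
  theta q y * theta q (- y) * theta q (y * s) * theta q (- y * s).
Proof.
rewrite /theta_prod 4!big_cons big_nil mulr1 divr1 !mulrA invrN1 mulrN1.
by rewrite invrN !invrK mulrN mulNr.
Qed.

Let theta_half y : y != 0 -> theta q (y^-1 * s) = theta q (y * s).
Proof.
move=> y0; rewrite -[RHS]theta_invol ?mulf_neq0 //.
by congr theta; rewrite -sq; field; rewrite y0 s0.
Qed.

Lemma odd_Theta_recip y : y != 0 ->
  theta_prod q odd_zeros y^-1 = - y ^- 2 * theta_prod q odd_zeros y.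
Proof.
move=> y0; have ny0 : - y != 0 by rewrite oppr_eq0.
rewrite !odd_ThetaE -(invrN y) theta_half // !theta_recip //.
by field.
Qed.

Lemma even_Theta_recip y : y != 0 ->
  theta_prod q even_zeros y^-1 = - y ^- 2 * theta_prod q even_zeros y.
Proof.
move=> y0; have ny0 : - y != 0 by rewrite oppr_eq0.
rewrite !even_ThetaE -(invrN y) !theta_half // !theta_recip //.
by field.
Qed.

Lemma odd_mult y : y != 0 -> theta_multiplier odd_zeros y = - (s * y ^+ 3)^-1.
Proof. by move=> y0; rewrite /theta_multiplier 3!big_cons big_nil; field; rewrite y0 s0. Qed.

Lemma even_mult y : y != 0 -> theta_multiplier even_zeros y = (q * y ^+ 4)^-1.
Proof. by move=> y0; rewrite /theta_multiplier 4!big_cons big_nil -sq; field; rewrite y0 s0. Qed.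

(** Both sides solve the functional equations with m = 0, so they are
proportional, and theta (y^2) does not vanish at an inner point y. *)
Lemma theta_sq_even : exists2 c : C, c != 0 &
  forall y, y != 0 -> theta_prod q even_zeros y = c * theta q (y ^+ 2).
Proof.
have tq : theta q q^-1 = 0.
  have iq0 : q^-1 != 0 by rewrite invr_eq0.
  have : theta q (q * q^-1) = - q^-1^-1 * theta q q^-1 by exact: theta_shift.
  rewrite mulfV // theta1 // invrK => /esym/eqP.
  by rewrite mulf_eq0 oppr_eq0 (negbTE q0) => /eqP.
have [|||| A [sig [_ tA]]] := @symmetric_theta_product R q q0 q1 even_zeros even_zeros_uniq
   even_zeros_window even_zeros_mod even_Theta_recip 0 (fun y => theta q (y ^+ 2)).
- move=> z z0; apply: holo_theta => //; first by apply: holo_exp; exact: holo_id.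
  have := holo_exp 2 (holo_inv z0); congr holo.
  by apply/funext => y; rewrite exprVn.
- move=> y y0; have y20 : y ^+ 2 != 0 by rewrite expf_neq0.
  have -> : (q * y) ^+ 2 = q * (q * y ^+ 2) by ring.
  rewrite theta_shift ?mulf_neq0 // theta_shift // even_mult // expr0.
  by field; rewrite y0 q0.
- move=> y y0; rewrite exprVn theta_recip ?expf_neq0 //.
- move=> x; rewrite !inE => /or4P[] /eqP ->; rewrite ?sqrrN ?expr1n ?theta1 //.
    by rewrite exprVn sq.
  by rewrite exprVn sq.
have [rho [ri _]] := inner_sequence q0 q1.
have r0 := inner_neq0 (ri 0%N); have /andP[r1 r2] := ri 0%N.
have tr : theta q (rho 0%N ^+ 2) != 0.
  have nr : 1 < nm (rho 0%N ^+ 2) by rewrite nmX exprn_egt1.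
  apply: theta_neq0 => //; last by apply: contraTneq nr => ->; rewrite nm1 ltxx.
  rewrite (lt_trans q1 nr) /= nmX -[ltRHS]mul1r ltr_pdivlMr // nm_gt0 //.
have A0 : A != 0.
  by apply: contra_neq tr => A0; rewrite tA // A0 !mul0r.
exists A^-1; first by rewrite invr_eq0.
by move=> y y0; rewrite tA // big_geq // mulr1 mulKf.
Qed.

End BaseProducts.

(** * Forced zeros and the theorem *)

Section WstarZeros.
Variable R : realType.
Local Notation C := (Cplx R).
Variables q s : C.
Hypotheses (q0 : q != 0) (sq : s ^+ 2 = q).
Variables (r : nat) (f : C -> C).
Hypothesis r3 : (3 <= r)%N.
Hypothesis fq : forall y, y != 0 ->
  f y = s ^ (r%:Z - 4%:Z) * (- y) ^+ (r - 2) * f (q * y).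
Hypothesis fi : forall y, y != 0 -> f y = - y ^+ 2 * f y^-1.

Let s0 : s != 0.
Proof. by apply: contra_neq q0 => e; rewrite -sq e expr0n. Qed.

Let opp_fix (c : C) : c = - c -> c = 0.
Proof.
move=> /eqP; rewrite -subr_eq0 opprK -mulr2n mulrn_eq0 /= => /eqP //.
Qed.

Lemma zero_at_1 : f 1 = 0.
Proof.
apply: opp_fix; rewrite [LHS]fi ?oner_neq0 // invr1 expr1n mulN1r //.
Qed.

Lemma zero_at_N1 : f (- 1) = 0.
Proof.
apply: opp_fix; rewrite [LHS]fi ?oppr_eq0 ?oner_neq0 // invrN1 sqrrN expr1n mulN1r //.
Qed.

(** The points 1/s and -1/s are fixed by the composition of y -> q y and
inversion; this power of s is the multiplier of the shift there, up to sign. *)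
Lemma spow : s ^ (r%:Z - 4%:Z) * (s^-1) ^+ (r - 2) = (s ^+ 2)^-1.
Proof.
rewrite exprVn exprnN [in RHS]exprnN -expfzDr //; congr (s ^ _); lia.
Qed.

Lemma zero_at_NsV : f (- s^-1) = 0.
Proof.
have n0 : - s^-1 != 0 by rewrite oppr_eq0 invr_eq0.
have ns0 : - s != 0 by rewrite oppr_eq0.
apply: opp_fix; rewrite [LHS]fq // opprK spow.
have -> : q * - s^-1 = - s by rewrite -sq; field.
by rewrite fi // sqrrN invrN; field.
Qed.

Lemma zero_at_sV : ~~ odd r -> f s^-1 = 0.
Proof.
move=> er; have n0 : s^-1 != 0 by rewrite invr_eq0.
have -> : s ^-1 = - - s^-1 by rewrite opprK.
apply: opp_fix; rewrite opprK [LHS]fq // exprNn -signr_odd oddB ?(ltnW r3) // addbF (negbTE er).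
rewrite expr0 mul1r spow.
have -> : q * s^-1 = s by rewrite -sq; field.
by rewrite fi //; field.
Qed.

End WstarZeros.

Theorem theorem1p3 (R : realType) (q s : Cplx R)
    (hq0 : 0 < `|q|) (hq1 : `|q| < 1) (hs : s ^+ 2 = q)
    (r : nat) (hr : (3 <= r)%N)
    (W : ('I_(r - 2) -> Cplx R) -> Cplx R -> Cplx R) (hW : is_Wstar q s r W)
    (a : 'I_(r - 2) -> Cplx R) (ha : forall i, a i != 0) :
  [/\ (r = 3%N \/ r = 4%N -> forall y : Cplx R, y != 0 -> W a y = 0),
      ((5 <= r)%N -> odd r ->
        exists (A : Cplx R) (rho : 'I_((r - 5)./2) -> Cplx R),
          (forall j, rho j != 0) /\
          forall y : Cplx R, y != 0 ->
            W a y = A * theta q y * theta q (- y) * theta q (- y * s)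
                    * \prod_j (theta q (y / rho j) * theta q (q * rho j * y)))
    & ((6 <= r)%N -> ~~ odd r ->
        exists (A : Cplx R) (rho : 'I_((r - 6)./2) -> Cplx R),
          (forall j, rho j != 0) /\
          forall y : Cplx R, y != 0 ->
            W a y = A * theta q (y ^+ 2)
                    * \prod_j (theta q (y / rho j) * theta q (q * rho j * y)))].
Proof.
have q0 : q != 0 by rewrite -normr_gt0.
have q1 : modulus q < 1 by move: hq1; rewrite -(normr1 (Cplx R)) lt_nm nm1.
have s0 : s != 0 by apply: contra_neq q0 => e; rewrite -hs e expr0n.
pose f := W a.
have hf : holo_off0 f.
  by move=> z z0; have [h _ _] := hW; apply: analytic_holo; exact: h.
have fq y : y != 0 -> f y = s ^ (r%:Z - 4%:Z) * (- y) ^+ (r - 2) * f (q * y).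
  exact: (Wstar_shift q0 q1 hs hr hW ha).
have fi y : y != 0 -> f y = - y ^+ 2 * f y^-1.
  exact: (Wstar_recip q0 q1 hs hr hW ha).
have fq' y : y != 0 -> f (q * y) = (s ^ (r%:Z - 4%:Z) * (- y) ^+ (r - 2))^-1 * f y.
  move=> y0; rewrite [in RHS]fq // mulKf // mulf_neq0 ?expfz_neq0 //.
  by rewrite expf_neq0 // oppr_eq0.
have fi' y : y != 0 -> f y^-1 = - y ^- 2 * f y.
  by move=> y0; rewrite fi ?invr_eq0 // invrK exprVn.
have z1 := zero_at_1 fi; have zN1 := zero_at_N1 fi.
have zNs := zero_at_NsV q0 hs hr fq fi.
have odd_f x : x \in odd_zeros s -> f x = 0.
  by rewrite !inE => /or3P[] /eqP ->.
have even_f : ~~ odd r -> forall x, x \in even_zeros s -> f x = 0.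
  move=> er x; have zs := zero_at_sV q0 hs hr fq fi er.
  by rewrite !inE => /or4P[] /eqP ->.
have fq_odd m y : (r = m.*2 + 5)%N -> y != 0 ->
    f (q * y) = theta_multiplier (odd_zeros s) y * (q * y ^+ 2) ^- m * f y.
  move=> rm y0; rewrite fq' //; congr (_ * _); rewrite (odd_mult q0 hs) //.
  have -> : s ^ (r%:Z - 4%:Z) = s * q ^+ m.
    by rewrite -hs -exprM -exprS exprnP; congr (s ^ _); rewrite rm; lia.
  have -> : (- y) ^+ (r - 2) = - (y ^+ 3 * (y ^+ 2) ^+ m).
    have -> : (r - 2 = m * 2 + 3)%N by rewrite rm; lia.
    by rewrite exprD mulnC exprM sqrrN; ring.
  by rewrite [(q * y ^+ 2) ^+ m]exprMn; move: (q ^+ m) ((y ^+ 2) ^+ m) => Q Y; rewrite mulNr -invfM -invrN; congr GRing.inv; ring.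
have fq_even m y : (r = m.*2 + 6)%N -> y != 0 ->
    f (q * y) = theta_multiplier (even_zeros s) y * (q * y ^+ 2) ^- m * f y.
  move=> rm y0; rewrite fq' //; congr (_ * _); rewrite (even_mult q0 hs) //.
  have -> : s ^ (r%:Z - 4%:Z) = q * q ^+ m.
    by rewrite -exprS -hs -exprM exprnP; congr (s ^ _); rewrite rm; lia.
  have -> : (- y) ^+ (r - 2) = y ^+ 4 * (y ^+ 2) ^+ m.
    have -> : (r - 2 = 2 * (m + 2))%N by rewrite rm; lia.
    by rewrite exprM sqrrN exprD mulrC -[(y ^+ 2) ^+ 2]exprM.
  by rewrite [(q * y ^+ 2) ^+ m]exprMn -invfM; congr GRing.inv; ring.
split.
- case=> rE.
    apply: (symmetric_theta_vanish q0 q1 (odd_zeros_uniq q1 hs) (odd_zeros_window q0 q1 hs)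
      (odd_zeros_mod q0 hs) (odd_Theta_recip q0 q1 hs) hf) => // y y0.
    rewrite fq' //; congr (_ * _); rewrite (odd_mult q0 hs) // rE -hs.
    rewrite -[_ - _]/(- 1%:Z) -exprnN expr1.
    by rewrite -[(3 - 2)%N]/1%N expr1; field; rewrite y0 s0.
  apply: (symmetric_theta_vanish q0 q1 (even_zeros_uniq q0 q1 hs) (even_zeros_window q0 q1 hs)
    (even_zeros_mod q0 hs) (even_Theta_recip q0 q1 hs) hf) => //.
    move=> y y0; rewrite fq' //; congr (_ * _); rewrite (even_mult q0 hs) // rE.
    rewrite -[_ - _]/(0%:Z) expr0z mul1r.
    by rewrite -[(4 - 2)%N]/2%N; field; rewrite y0 q0.
  by apply: even_f; rewrite rE.
- move=> r5 ro; pose m := (r - 5)./2.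
  have rm : (r = m.*2 + 5)%N by rewrite /m; move: ro; lia.
  have [A [rho [rn0 fA]]] := symmetric_theta_product q0 q1 (odd_zeros_uniq q1 hs)
    (odd_zeros_window q0 q1 hs) (odd_zeros_mod q0 hs) (odd_Theta_recip q0 q1 hs) hf
    (fun y => @fq_odd m y rm) fi' odd_f.
  exists A, (fun j => rho j); split=> // y y0.
  by rewrite -/f fA // odd_ThetaE big_mkord !mulrA.
- move=> r6 re; pose m := (r - 6)./2.
  have rm : (r = m.*2 + 6)%N by rewrite /m; move: re; lia.
  have [A [rho [rn0 fA]]] := symmetric_theta_product q0 q1 (even_zeros_uniq q0 q1 hs)
    (even_zeros_window q0 q1 hs) (even_zeros_mod q0 hs) (even_Theta_recip q0 q1 hs) hf
    (fun y => @fq_even m y rm) fi' (even_f re).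
  have [c c0 cP] := theta_sq_even q0 q1 hs.
  exists (A * c), (fun j => rho j); split=> // y y0.
  by rewrite -/f fA // cP // big_mkord !mulrA.
Qed.
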